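(* Let $\mathfrak s=\mathbb R b\oplus\tilde{\mathfrak s}$ be the $(n+1)$-dimensional Lie algebra ($n\ge 2$) that extends the abelian Lie algebra $\tilde{\mathfrak s}$ by a symmetric operator $L$ with eigenvalues $\mu_1\le\mu_2\le\dots\le\mu_n$, all different from zero. Let $\alpha\in\mathbb R$. The Weyl connection defined by the left invariant vector field $E=\alpha b$ is non-positive if and only if (1) in the case $\mu_1<0<\mu_n$: $\alpha=\mu_1$ and all the negative eigenvalues are equal to $\mu_1$, or $\alpha=\mu_n$ and all the positive eigenvalues are equal to $\mu_n$; (2) in the case $\mu_1>0$ (respectively $\mu_n<0$): $\alpha\le\mu_1$ (respectively $\alpha\ge\mu_n$).
   Context: Setting. $\tilde{\mathfrak s}$ is an abelian Lie algebra of dimension $n$, $L:\tilde{\mathfrak s}\to\tilde{\mathfrak s}$ is linear, and $\mathfrak s=\mathbb R b\oplus\tilde{\mathfrak s}$ has bracket $[b,u]=Lu$ and $[u,v]=0$ for $u,v\in\tilde{\mathfrak s}$. $\mathfrak s$ has a scalar product $\langle\cdot,\cdot\rangle$ in which $b$ is a unit vector orthogonal to $\tilde{\mathfrak s}$, and $L$ is symmetric with respect to it. A Lie group $S$ with Lie algebra $\mathfrak s$ carries the corresponding left invariant metric, and elements of $\mathfrak s$ are viewed as left invariant vector fields on $S$. Weyl connections. On a Riemannian manifold with metric $\langle\cdot,\cdot\rangle$, Levi-Civita connection $\nabla$ and sectional curvature $K$, for a vector field $E$ let $\varphi=\langle E,\cdot\rangle$. The Weyl connection defined by $E$ is $\widehat\nabla_XY=\nabla_XY+\varphi(Y)X+\varphi(X)Y-\langle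 X,Y\rangle E$. Let $\widehat R(X,Y)=\widehat\nabla_X\widehat\nabla_Y-\widehat\nabla_Y\widehat\nabla_X-\widehat\nabla_{[X,Y]}$ and $\widehat R_a(X,Y)=\widehat R(X,Y)-d\varphi(X,Y)I$ its anti-symmetric part. For a tangent plane $\Pi$ with orthonormal basis $\{X,Y\}$ put $\widehat K(\Pi)=\langle\widehat R_a(X,Y)Y,X\rangle$; equivalently $\widehat K(\Pi)=K(\Pi)-|E_\perp|^2-\langle\nabla_XE,X\rangle-\langle\nabla_YE,Y\rangle$, where $E_\perp$ is the component of $E$ orthogonal to $\Pi$. The Weyl connection is non-positive if $\widehat K(\Pi)\le 0$ for every tangent plane $\Pi$ at every point. *)

(* Defs.v *)
From mathcomp Require Import all_boot all_order all_algebra.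
From mathcomp Require Import all_classical all_reals all_analysis.
Set Implicit Arguments.
Unset Strict Implicit.
Unset Printing Implicit Defensive.
Import Order.TTheory GRing.Theory Num.Theory.
Import numFieldNormedType.Exports.

Local Open Scope classical_set_scope.
Local Open Scope ring_scope.

(* C^k functions on an open set: the iterated directional derivatives up to
   order k exist, are continuous, and those of order < k are differentiable. *)
Fixpoint Ck_on (R : realType) (V W : normedModType R) (k : nat)
    (A : set V) (f : V -> W) : Prop :=
  match k with
  | 0 => forall x, A x -> {for x, continuous f}
  | k'.+1 => (forall x, A x -> differentiable f x) /\
             (forall v : V, Ck_on k' A (fun x => 'D_v f x))
  end.

Definition smooth_on (R : realType) (V W : normedModType R)
    (A : set V) (f : V -> W) : Prop := forall k, Ck_on k A f.

(* A smooth m-manifold, given by an atlas containing one preferred chart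
   [chart p : dom p -> 'rV_m], with inverse [param p], around each point p;
   the values of [chart p] outside [dom p] and of [param p] outside the image
   are irrelevant. *)
Record manifold (R : realType) (m : nat) := Manifold {
  carrier :> topologicalType;
  dom : carrier -> set carrier;
  chart : carrier -> carrier -> 'rV[R]_m;
  param : carrier -> 'rV[R]_m -> carrier;
  manifold_hausdorff : hausdorff_space carrier;
  manifold_second_countable : @second_countable carrier;
  dom_open : forall p, open (dom p);
  dom_mem : forall p, dom p p;
  chart_open : forall p, open (chart p @` dom p);
  chartK : forall p q, dom p q -> param p (chart p q) = q;
  chart_continuous : forall p q, dom p q -> {for q, continuous (chart p)};
  param_continuous : forall p u, (chart p @` dom p) u ->
    {for u, continuous (param p)};
  transition_smooth : forall p q,
    smooth_on (chart p @` (dom p `&` dom q)) (chart q \o param p)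
}.

Section Manifold.
Context {R : realType} {m : nat}.
Variable M : manifold R m.

Definition smooth_fun (W : normedModType R) (f : M -> W) : Prop :=
  forall p : M, smooth_on (chart p @` dom p) (f \o param p).

(* The tangent space at p is identified with 'rV_m by means of the preferred
   chart at p: a vector field assigns to p the components of its value at p
   in [chart p]. *)
Definition vfield := M -> 'rV[R]_m.

(* X f, the derivative of f along X *)
Definition lie_deriv (W : normedModType R) (X : vfield) (f : M -> W) : M -> W :=
  fun p => 'D_(X p) (f \o param p) (chart p p).

(* For q in dom p, [lie_deriv X (chart p) q] is the vector of the components
   of X at q in the chart [chart p] (and not [chart q]). *)
Definition smooth_vfield (X : vfield) : Prop :=
  forall p : M, smooth_on (chart p @` dom p) (lie_deriv X (chart p) \o param p).

(* [X, Y]^i = X (Y^i) - Y (X^i), with components in the chart at p. *)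
Definition lie_bracket (X Y : vfield) : vfield :=
  fun p => lie_deriv X (lie_deriv Y (chart p)) p
         - lie_deriv Y (lie_deriv X (chart p)) p.

(* The tangent map of F : M -> M at p, from T_p M to T_(F p) M. *)
Definition tangent_map (F : M -> M) (p : M) (v : 'rV[R]_m) : 'rV[R]_m :=
  'D_v (chart (F p) \o F \o param p) (chart p p).

End Manifold.

Definition scalar_product (R : realType) (V : lmodType R) (h : V -> V -> R) :
    Prop :=
  [/\ forall (a : R) (u v w : V), h (a *: u + v) w = a * h u w + h v w,
      forall u v : V, h u v = h v u
    & forall u : V, u != 0 -> 0 < h u u].

Section Riemannian.
Context {R : realType} {m : nat}.
Variable M : manifold R m.
Implicit Types (g : M -> 'rV[R]_m -> 'rV[R]_m -> R).
Implicit Types (X Y Z E : vfield M) (D nabla : vfield M -> vfield M -> vfield M).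

(* <X, Y> as a function on M *)
Definition pairing g X Y : M -> R := fun p => g p (X p) (Y p).

Definition riemannian_metric g : Prop :=
  (forall p : M, scalar_product (g p)) /\
  (forall X Y, smooth_vfield X -> smooth_vfield Y -> smooth_fun (pairing g X Y)).

(* nabla X Y stands for nabla_X Y; its values on non-smooth fields are
   irrelevant. *)
Record levi_civita g nabla : Prop := LeviCivita {
  lc_smooth : forall X Y, smooth_vfield X -> smooth_vfield Y ->
    smooth_vfield (nabla X Y);
  lc_linear_l : forall (f : M -> R) X X' Y, smooth_fun f ->
    smooth_vfield X -> smooth_vfield X' -> smooth_vfield Y ->
    nabla (fun p => f p *: X p + X' p) Y
    = (fun p => f p *: nabla X Y p + nabla X' Y p);
  lc_leibniz_r : forall (f : M -> R) X Y Y', smooth_fun f ->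
    smooth_vfield X -> smooth_vfield Y -> smooth_vfield Y' ->
    nabla X (fun p => f p *: Y p + Y' p)
    = (fun p => f p *: nabla X Y p + lie_deriv X f p *: Y p + nabla X Y' p);
  lc_torsion_free : forall X Y, smooth_vfield X -> smooth_vfield Y ->
    forall p, nabla X Y p - nabla Y X p = lie_bracket X Y p;
  lc_metric : forall X Y Z,
    smooth_vfield X -> smooth_vfield Y -> smooth_vfield Z ->
    forall p, lie_deriv X (pairing g Y Z) p
              = g p (nabla X Y p) (Z p) + g p (Y p) (nabla X Z p)
}.

(* The Weyl connection defined by E, with phi = <E, .>. *)
Definition weyl g nabla E : vfield M -> vfield M -> vfield M :=
  fun X Y p => nabla X Y p + pairing g E Y p *: X p + pairing g E X p *: Y p
               - pairing g X Y p *: E p.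

Definition curvature D X Y Z : vfield M :=
  fun p => D X (D Y Z) p - D Y (D X Z) p - D (lie_bracket X Y) Z p.

(* d phi (X, Y), with phi = <E, .> *)
Definition dform g E X Y : M -> R :=
  fun p => lie_deriv X (pairing g E Y) p - lie_deriv Y (pairing g E X) p
           - pairing g E (lie_bracket X Y) p.

Definition curvature_anti g nabla E X Y Z : vfield M :=
  fun p => curvature (weyl g nabla E) X Y Z p - dform g E X Y p *: Z p.

(* At a point p where X and Y are orthonormal, the sectional curvature of the
   Weyl connection on the plane that they span. *)
Definition weyl_sect g nabla E X Y : M -> R :=
  pairing g (curvature_anti g nabla E X Y Y) X.

Definition weyl_nonpositive g nabla E : Prop :=
  forall (p : M) X Y, smooth_vfield X -> smooth_vfield Y ->
    g p (X p) (X p) = 1 -> g p (Y p) (Y p) = 1 -> g p (X p) (Y p) = 0 ->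
    weyl_sect g nabla E X Y p <= 0.

End Riemannian.

Record lie_group (R : realType) (m : nat) := LieGroup {
  lie_manifold :> manifold R m;
  gmul : lie_manifold -> lie_manifold -> lie_manifold;
  gone : lie_manifold;
  ginv : lie_manifold -> lie_manifold;
  gmulA : associative gmul;
  gmul1 : left_id gone gmul;
  gmulV : left_inverse gone ginv gmul;
  gmul_continuous :
    continuous (fun z : lie_manifold * lie_manifold => gmul z.1 z.2);
  gmul_smooth : forall p q r : lie_manifold,
    smooth_on
      [set u : 'rV[R]_m * 'rV[R]_m |
         [/\ (chart p @` dom p) u.1, (chart q @` dom q) u.2
           & dom r (gmul (param p u.1) (param q u.2))]]
      (fun u : 'rV[R]_m * 'rV[R]_m =>
         chart r (gmul (param p u.1) (param q u.2)));
  ginv_continuous : continuous ginv;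
  ginv_smooth : forall p q : lie_manifold,
    smooth_on (chart p @` (dom p `&` ginv @^-1` dom q))
      (chart q \o ginv \o param p)
}.

Section LieGroup.
Context {R : realType} {m : nat}.
Variable S : lie_group R m.

Definition left_invariant (X : vfield S) : Prop :=
  smooth_vfield X /\
  forall h p : S, tangent_map (gmul h) p (X p) = X (gmul h p).

(* iota identifies the Lie algebra (V, br) with the Lie algebra of left
   invariant vector fields on S. *)
Record lie_algebra_iso (V : lmodType R) (br : V -> V -> V)
    (iota : V -> vfield S) : Prop := LieAlgebraIso {
  iota_linear : forall (a : R) (x y : V) (p : S),
    iota (a *: x + y) p = a *: iota x p + iota y p;
  iota_inj : injective iota;
  iota_left_invariant : forall x : V, left_invariant (iota x);
  iota_surj : forall X : vfield S, left_invariant X -> exists x, X = iota x;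
  iota_bracket : forall x y : V,
    iota (br x y) = lie_bracket (iota x) (iota y)
}.

(* g is left invariant and restricts to ip at the identity. *)
Definition left_invariant_metric (V : lmodType R) (ip : V -> V -> R)
    (iota : V -> vfield S) (g : S -> 'rV[R]_m -> 'rV[R]_m -> R) : Prop :=
  [/\ riemannian_metric g,
      forall (h p : S) (v w : 'rV[R]_m),
        g (gmul h p) (tangent_map (gmul h) p v) (tangent_map (gmul h) p w)
        = g p v w
    & forall x y : V, g (gone S) (iota x (gone S)) (iota y (gone S)) = ip x y].

End LieGroup.

(* The Lie algebra R b + s~, with s~ = R^n, as the set of pairs (c, u) standing
   for c b + u. *)
Definition ext_alg (R : realType) (n : nat) : lmodType R :=
  (R^o * 'rV[R]_n)%type.

Section Extension.
Context {R : realType} {n : nat}.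

Definition ext_b : ext_alg R n := (1, 0).
Definition ext_incl (u : 'rV[R]_n) : ext_alg R n := (0, u).

(* The bracket with [b, u] = L u and [u, v] = 0, extended bilinearly and
   antisymmetrically. *)
Definition ext_bracket (L : 'rV[R]_n -> 'rV[R]_n) (x y : ext_alg R n) :
    ext_alg R n := (0, x.1 *: L y.2 - y.1 *: L x.2).

End Extension.

(* The eigenvalues of L, repeated according to multiplicity, in increasing
   order. *)
Definition sorted_eigenvalues (R : realType) (n : nat)
    (L : {linear 'rV[R]_n -> 'rV[R]_n}) (mu : n.-tuple R) : Prop :=
  sorted <=%R mu /\ char_poly (lin1_mx L) = \prod_(a <- mu) ('X - a%:P).

(* Main.v *)
From HB Require Import structures.
Require Import Defs.
From mathcomp Require Import all_boot all_order all_algebra.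
From mathcomp Require Import all_classical all_reals all_analysis.
From mathcomp Require Import ring lra.
Set Implicit Arguments.
Unset Strict Implicit.
Unset Printing Implicit Defensive.
Import Order.TTheory GRing.Theory Num.Theory.
Import numFieldNormedType.Exports.
Local Open Scope ring_scope.

(** On the Lie algebra level, write x = s b + u and y = t b + v for an
    orthonormal pair and let A = L - alpha. The Koszul formula, whose derivative
    terms vanish on left invariant fields, gives the Levi-Civita connection and
    hence the Weyl connection as bilinear products on the Lie algebra; expanding
    the curvature and using the orthonormality relations yields, with
    w = s v - t u,
      - (<Au, u> <Av, v> - <Au, v> ^ 2) - (|Lw| ^ 2 - alpha <Lw, w>)
    for the sectional curvature of the Weyl connection ([weyl_form_curvature]).

    This is non-positive for all orthonormal pairs if and only if
    (c - alpha) (d - alpha) >= 0 for any two different eigenvalues c and d, and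
    c (c - alpha) >= 0 for every eigenvalue c ([weyl_form_npos]). Necessity is
    seen on planes spanned by two eigenvectors and on planes spanned by b and an
    eigenvector. Conversely, the first condition says that all eigenvalues lie
    on the same side of alpha, so A or - A is positive semi-definite and
    Cauchy-Schwarz makes the first term non-positive; the second condition does
    the same for the second term, after w is decomposed into eigenvectors. The
    cases of the theorem are what the two conditions say about the smallest and
    the largest eigenvalue.

    Non-positivity is a condition on arbitrary smooth vector fields, so the
    curvature of a torsion-free connection has to be shown to depend on the
    values of its arguments at one point only ([curvature_local]). As the left
    invariant fields form a global frame with constant scalar products, every
    smooth field is a combination of them with smooth coefficients, and it
    suffices that the curvature is linear over smooth functions in each slot. In
    the last slot this rests on [X, Y] f = X (Y f) - Y (X f)
    ([lie_deriv_bracket]), that is, on the symmetry of second derivatives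
    ([derive_schwarz]). The other properties of the bracket are read off from
    the identity [X, Y] = D_X Y - D_Y X. *)

(** * Scalar products and symmetric operators *)

Section ScalarProduct.
Context {R : realType} {V : lmodType R}.
Variable h : V -> V -> R.
Hypothesis hP : scalar_product h.

Lemma spC u v : h u v = h v u.
Proof. by case: hP. Qed.

Lemma sp0l v : h 0 v = 0.
Proof.
case: hP => hl _ _; have := hl 1 0 0 v.
by rewrite scaler0 addr0 mul1r => /eqP; rewrite -subr_eq subrr eq_sym => /eqP.
Qed.

Lemma spDl u w v : h (u + w) v = h u v + h w v.
Proof. by case: hP => hl _ _; rewrite -[u in LHS]scale1r hl mul1r. Qed.

Lemma spZl a u v : h (a *: u) v = a * h u v.
Proof. by case: hP => hl _ _; rewrite -[a *: u]addr0 hl sp0l addr0. Qed.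

Lemma sp0r v : h v 0 = 0. Proof. by rewrite spC sp0l. Qed.

Lemma spDr u v w : h v (u + w) = h v u + h v w.
Proof. by rewrite spC spDl !(spC v). Qed.

Lemma spZr a u v : h v (a *: u) = a * h v u.
Proof. by rewrite spC spZl spC. Qed.

Lemma spNl u v : h (- u) v = - h u v.
Proof. by rewrite -scaleN1r spZl mulN1r. Qed.

Lemma spNr u v : h v (- u) = - h v u.
Proof. by rewrite spC spNl spC. Qed.

Lemma spBl u w v : h (u - w) v = h u v - h w v.
Proof. by rewrite spDl spNl. Qed.

Lemma sp_suml I (s : seq I) (P : pred I) (F : I -> V) v :
  h (\sum_(i <- s | P i) F i) v = \sum_(i <- s | P i) h (F i) v.
Proof. by elim/big_rec2: _ => [|i x y _ <-]; rewrite ?sp0l ?spDl. Qed.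

Lemma sp_sumr I (s : seq I) (P : pred I) (F : I -> V) v :
  h v (\sum_(i <- s | P i) F i) = \sum_(i <- s | P i) h v (F i).
Proof. by rewrite spC sp_suml; apply: eq_bigr => i _; rewrite spC. Qed.

Lemma sp_ge0 u : 0 <= h u u.
Proof.
by case: hP => _ _ p; have [->|/p/ltW//] := eqVneq u 0; rewrite sp0l.
Qed.

Lemma sp_eq0 u : h u u = 0 -> u = 0.
Proof.
case: hP => _ _ p h0; apply/eqP; apply: contraT => /p.
by rewrite h0 ltxx.
Qed.

Lemma sp_inj u v : (forall w, h u w = h v w) -> u = v.
Proof.
by move=> e; apply/eqP; rewrite -subr_eq0; apply/eqP/sp_eq0; rewrite spBl e subrr.
Qed.

Lemma sp_unit u : u != 0 -> exists a, h (a *: u) (a *: u) = 1.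
Proof.
case: hP => _ _ p /p hu; exists (Num.sqrt (h u u))^-1.
rewrite spZl spZr mulrA -invfM -expr2 sqr_sqrtr ?ltW// mulVf//.
by rewrite gt_eqF.
Qed.

(** The form <A (a u + c v), a u + c v> is a non-negative quadratic polynomial in
    a and c, hence has non-negative discriminant. Semi-definiteness is all that
    is available for L - alpha when alpha is an eigenvalue of L. *)
Lemma semidefinite_CS (A : V -> V) :
  linear A -> (forall u v, h (A u) v = h u (A v)) ->
  (forall u, 0 <= h (A u) u) ->
  forall u v, h (A u) v ^+ 2 <= h (A u) u * h (A v) v.
Proof.
move=> Al As Ap u v.
have Asym : h (A v) u = h (A u) v by rewrite As spC.
have key a c : 0 <= a ^+ 2 * h (A u) u + 2 * a * c * h (A u) v
                    + c ^+ 2 * h (A v) v.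
  have A0 : A 0 = 0.
    by have := Al (-1) 0 0; rewrite scaler0 addr0 scaleN1r addNr.
  have AZ d w : A (d *: w) = d *: A w by rewrite -[d *: w]addr0 Al A0 addr0.
  have := Ap (a *: u + c *: v).
  rewrite Al AZ !(spDl, spDr, spZl, spZr) Asym.
  by congr (0 <= _); ring.
set p := h (A u) u; set q := h (A u) v; set r := h (A v) v.
have p0 : 0 <= p := Ap u.
have [p_eq0|p_neq0] := eqVneq p 0.
  (* Here q must vanish: the discriminant argument degenerates, but the
     coefficients -(r + 1) and q turn the form into - q ^ 2 (r + 2). *)
  have r0 : 0 <= r := Ap v.
  have := key (- (r + 1)) q; rewrite -/p -/q -/r p_eq0 mulr0 add0r => k.
  have q2 : 0 <= q ^+ 2 by apply: sqr_ge0.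
  nra.
have {}p0 : 0 < p by rewrite lt_def p_neq0.
have := key (- q) p; rewrite -/p -/q -/r => k.
have : 0 <= p * (p * r - q ^+ 2) by move: k; congr (0 <= _); ring.
by rewrite pmulr_rge0// subr_ge0.
Qed.

End ScalarProduct.

Section Spectral.
Context {R : realType} {n : nat}.
Variable h : 'rV[R]_n -> 'rV[R]_n -> R.
Hypothesis hP : scalar_product h.
Variable L : {linear 'rV[R]_n -> 'rV[R]_n}.
Hypothesis Lsym : forall u v, h (L u) v = h u (L v).

Lemma eigenvector_orthogonal a c u v : L u = a *: u -> L v = c *: v ->
  a != c -> h u v = 0.
Proof.
move=> Lu Lv ac; have := Lsym u v.
rewrite Lu Lv spZl// spZr// => /eqP; rewrite -subr_eq0 -mulrBl mulf_eq0 subr_eq0.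
by rewrite (negbTE ac) => /eqP.
Qed.

Lemma unit_eigenvector (mu : n.-tuple R) a :
  char_poly (lin1_mx L) = \prod_(x <- mu) ('X - x%:P) -> a \in mu ->
  exists2 u, L u = a *: u & h u u = 1.
Proof.
move=> charL amu.
have : eigenvalue (lin1_mx L) a.
  by rewrite eigenvalue_root_char charL root_prod_XsubC.
case/eigenvalueP => u; rewrite mul_rV_lin1 => Lu /(sp_unit hP)[c cu].
by exists (c *: u); rewrite // linearZ/= Lu !scalerA mulrC.
Qed.

(** A symmetric operator has no nilpotent part, because
    |C ^ k u| ^ 2 = <C ^ (k + 1) u, C ^ (k - 1) u>. *)
Lemma symmetric_nilpotent (C : 'rV[R]_n -> 'rV[R]_n) k :
  (forall u v, h (C u) v = h u (C v)) -> (forall u, iter k.+1 C u = 0) ->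
  forall u, C u = 0.
Proof.
move=> Csym; elim: k => [|k IHk] C0 u; first exact: C0.
apply: IHk => {}u; apply: (sp_eq0 hP).
by rewrite {2}iterS -Csym -iterS C0 sp0l.
Qed.

End Spectral.

(** Cayley-Hamilton makes q(L) nilpotent, where q has each eigenvalue as a
    simple root; being symmetric, q(L) vanishes. Hence the minimal polynomial
    has simple roots and the eigenspaces fill the space. *)
Lemma spectral_decomposition (R : realType) (n : nat)
  (h : 'rV[R]_n -> 'rV[R]_n -> R) (hP : scalar_product h)
  (L : {linear 'rV[R]_n -> 'rV[R]_n})
  (Lsym : forall u v, h (L u) v = h u (L v)) (mu : n.-tuple R)
  (charL : char_poly (lin1_mx L) = \prod_(a <- mu) ('X - a%:P)) w :
  exists2 c : R -> 'rV[R]_n,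
    w = \sum_(a <- undup mu) c a & forall a, a \in mu -> L (c a) = a *: c a.
Proof.
case: n h hP L Lsym mu charL w => [|n] h hP L Lsym mu charL w.
  by exists (fun=> 0) => [|a _]; rewrite ?big1 ?thinmx0// linear0 scaler0.
pose A := lin1_mx L; pose q := \prod_(a <- undup mu) ('X - a%:P).
have dvdq : char_poly A %| q ^+ size mu.
  rewrite charL; have : {subset (mu : seq R) <= undup mu}.
    by move=> a; rewrite mem_undup.
  rewrite {}/q; move: (undup mu) => d.
  elim: (mu : seq R) => [|a s IHs] sub; first by rewrite big_nil dvd1p.
  rewrite big_cons [size _]/= exprS; apply: dvdp_mul.
    by rewrite dvdp_XsubCl root_prod_XsubC sub ?mem_head.
  by apply: IHs => b bs; apply: sub; rewrite inE bs orbT.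
have hornerAq p u v : h (u *m horner_mx A p) v = h u (v *m horner_mx A p).
  elim/poly_ind: p u v => [|p c IHp] u v.
    by rewrite rmorph0 !mulmx0 sp0l ?sp0r.
  have -> : horner_mx A (p * 'X + c%:P) = horner_mx A p *m A + c%:M.
    by rewrite rmorphD rmorphM/= horner_mx_X horner_mx_C.
  have ApA : horner_mx A p *m A = A *m horner_mx A p by apply: comm_horner_mx.
  rewrite !mulmxDr !mul_mx_scalar (spDl hP) (spDr hP) (spZl hP) (spZr hP) {2}ApA.
  by rewrite !mulmxA !(mul_rV_lin1 L) Lsym IHp.
have q0 : horner_mx A q = 0.
  have k0 : size mu = n.+1 by rewrite size_tuple.
  have iterE k u : iter k (mulmxr (horner_mx A q)) u = u *m horner_mx A (q ^+ k).
    elim: k => [|k IHk]; first by rewrite expr0 rmorph1 mulmx1.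
    by rewrite iterS IHk /= exprSr rmorphM/= mulmxA.
  apply/row_matrixP => i; rewrite row0 rowE.
  apply: (@symmetric_nilpotent _ _ h hP (mulmxr (horner_mx A q)) n).
    by move=> u v; apply: hornerAq.
  move=> u; rewrite iterE; move: dvdq; rewrite k0.
  case/dvdpP=> r ->.
  by rewrite rmorphM/= Cayley_Hamilton mulr0 mulmx0.
have full : (\sum_(i < size (undup mu)) eigenspace A (undup mu)`_i :=: 1%:M)%MS.
  rewrite (eq_bigr _ (fun _ _ => eigenspace_poly _ _)).
  apply: (eqmx_trans (eqmx_sym (kermxpoly_prod _ _)) (kermxpoly_min _)) => //.
    by move=> i j _ _; rewrite coprimep_XsubC root_XsubC nth_uniq ?undup_uniq.
  have := mxminpoly_min q0.
  by rewrite /q (big_nth 0) big_mkord.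
have : (w <= \sum_(i < size (undup mu)) eigenspace A (undup mu)`_i)%MS.
  by rewrite full submx1.
case/sub_sumsmxP => f wE.
exists (fun a => if insub (index a (undup mu)) is Some i
                 then f i *m eigenspace A (undup mu)`_i else 0).
  rewrite wE (big_nth 0) big_mkord; apply: eq_bigr => i _.
  by rewrite index_uniq ?undup_uniq// valK.
move=> a amu; case: insubP => [i _ iE|]; last first.
  by rewrite index_mem mem_undup amu.
rewrite iE nth_index ?mem_undup//.
by rewrite -mul_rV_lin1; apply/eigenspaceP; rewrite submxMl.
Qed.

(** Eigenvectors for different eigenvalues are orthogonal, so in the spectral
    decomposition of w these three quadratic forms become diagonal; e a is the
    square norm of the component of w with eigenvalue a. *)
Lemma spectral_form (R : realType) (n : nat)
  (h : 'rV[R]_n -> 'rV[R]_n -> R) (hP : scalar_product h)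
  (L : {linear 'rV[R]_n -> 'rV[R]_n})
  (Lsym : forall u v, h (L u) v = h u (L v)) (mu : n.-tuple R)
  (charL : char_poly (lin1_mx L) = \prod_(a <- mu) ('X - a%:P)) w :
  exists2 e : R -> R, forall a, 0 <= e a &
    [/\ h w w = \sum_(a <- undup mu) e a,
        h (L w) w = \sum_(a <- undup mu) a * e a
      & h (L w) (L w) = \sum_(a <- undup mu) a ^+ 2 * e a].
Proof.
have [c wE Lc] := spectral_decomposition hP Lsym charL w.
have Lw : L w = \sum_(a <- undup mu) a *: c a.
  rewrite wE linear_sum; apply: eq_big_seq => a.
  by rewrite mem_undup => /Lc.
have wE1 : w = \sum_(a <- undup mu) 1 *: c a.
  by rewrite wE; apply: eq_bigr => a _; rewrite scale1r.
have key (f k : R -> R) :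
    h (\sum_(a <- undup mu) f a *: c a) (\sum_(a <- undup mu) k a *: c a)
    = \sum_(a <- undup mu) f a * k a * h (c a) (c a).
  rewrite sp_suml//; apply: eq_big_seq => a; rewrite mem_undup => amu.
  rewrite sp_sumr// (bigD1_seq a) ?mem_undup ?undup_uniq//=.
  rewrite spZl// spZr// mulrA [X in _ + X]big_seq_cond big1 ?addr0// => d.
  rewrite mem_undup => /andP[dmu da].
  rewrite spZl// spZr// (eigenvector_orthogonal hP Lsym (Lc _ amu) (Lc _ dmu)).
    by rewrite !mulr0.
  by rewrite eq_sym.
exists (fun a => h (c a) (c a)); first by move=> a; apply: sp_ge0.
split.
- by rewrite wE1 key; apply: eq_bigr => a _; rewrite !mul1r.
- by rewrite Lw wE1 key; apply: eq_bigr => a _; rewrite mulr1.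
- by rewrite Lw key; apply: eq_bigr => a _; rewrite expr2.
Qed.

(** * Smooth functions on an open set *)

Local Open Scope classical_set_scope.
Local Open Scope ring_scope.

(** Write g = f + (g - f): the difference vanishes near x, so 0 serves as its
    differential. *)
Lemma near_eq_differentiable (R : realType) (V W : normedModType R)
  (f g : V -> W) x :
  (\near x, f x = g x) -> differentiable f x -> differentiable g x.
Proof.
move=> fg df; pose k : V -> W := g - f.
have -> : g = f + k by rewrite funeqE => y; rewrite /k !fctE addrC subrK.
apply: differentiableD => //.
have k0 : \forall y \near x, k y = 0.
  by near=> y; rewrite /k !fctE (near fg y)// subrr.
have kx : k x = 0 by apply: nbhs_singleton k0.
have E : k \o shift x = cst (k x) + (0 : V -> W) +o_ (nbhs (0 : V)) id.
  apply/eqaddoP => e e0; near=> y; rewrite !fctE /= kx !addr0 subr0.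
  suff -> : k (y + x) = 0 by rewrite normr0 mulr_ge0// ltW.
  near: y; have c : {for (0 : V), continuous (fun y : V => y + x)}.
    by apply: continuousD; [exact: cvg_id|exact: cst_continuous].
  by apply: (c [set z | k z = 0]); rewrite add0r.
have d0 : 'd k x = (0 : V -> W) :> (V -> W).
  by apply: diff_unique => //; exact: cst_continuous.
by apply/diff_locallyP; rewrite d0; split => //; exact: cst_continuous.
Unshelve. all: by end_near. Qed.

Section Smooth.
Context {R : realType} {V : normedModType R}.
Variable A : set V.
Hypothesis openA : open A.

Lemma near_open x (P : V -> Prop) : A x -> (forall y, A y -> P y) ->
  \forall y \near x, P y.
Proof.
move=> Ax AP; have : nbhs x A by apply: open_nbhs_nbhs; split.
by apply: filterS => y /AP.
Qed.

(** Values outside of A do not matter since A is open. This lets the formulas for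
    derivatives, which hold on A only, be used in the inductions on k. *)
Lemma Ck_on_ext (W : normedModType R) k (f g : V -> W) :
  (forall x, A x -> f x = g x) -> Ck_on k A f -> Ck_on k A g.
Proof.
elim: k f g => [|k IHk] f g fg /=.
  move=> cf x Ax; rewrite /prop_for /continuous_at -(fg x Ax).
  apply: cvg_trans (cf x Ax); apply: near_eq_cvg.
  by apply: near_open Ax _.
move=> [df Dfk]; split=> [x Ax|v].
  apply: near_eq_differentiable (df x Ax); exact: near_open Ax _.
apply: IHk (Dfk v) => x Ax; apply: near_eq_derive; exact: near_open Ax _.
Qed.

Lemma smooth_on_diff (W : normedModType R) (f : V -> W) x :
  smooth_on A f -> A x -> differentiable f x.
Proof. by move=> /(_ 1%N)[df _] /df. Qed.

Lemma smooth_on_cont (W : normedModType R) (f : V -> W) x :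
  smooth_on A f -> A x -> {for x, continuous f}.
Proof. by move=> /(_ 0%N) /[apply]. Qed.

Lemma smooth_on_derive (W : normedModType R) (f : V -> W) v :
  smooth_on A f -> smooth_on A ('D_v f).
Proof. by move=> sf k; have [_] := sf k.+1; apply. Qed.

Lemma smooth_on_ext (W : normedModType R) (f g : V -> W) :
  (forall x, A x -> f x = g x) -> smooth_on A f -> smooth_on A g.
Proof. by move=> fg sf k; apply: Ck_on_ext fg (sf k). Qed.

Lemma smooth_on_cst (W : normedModType R) (c : W) : smooth_on A (fun=> c).
Proof.
move=> k; elim: k c => [|k IHk] c /=; first by move=> x _; exact: cst_continuous.
split=> [x _|v]; first exact: differentiable_cst.
apply: Ck_on_ext (IHk 0) => x _; apply/esym/derive_cst.
Qed.

Lemma Ck_onD (W : normedModType R) k (f g : V -> W) :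
  Ck_on k A f -> Ck_on k A g -> Ck_on k A (fun x => f x + g x).
Proof.
elim: k f g => [|k IHk] f g.
  by move=> cf cg x Ax; apply: continuousD; [apply: cf|apply: cg].
move=> [df Df] [dg Dg]; split=> [x Ax|v].
  by apply: differentiableD; [apply: df|apply: dg].
apply: Ck_on_ext (IHk _ _ (Df v) (Dg v)) => x Ax.
by rewrite -deriveD//; apply: diff_derivable; [apply: df|apply: dg].
Qed.

Lemma smooth_onD (W : normedModType R) (f g : V -> W) :
  smooth_on A f -> smooth_on A g -> smooth_on A (fun x => f x + g x).
Proof. by move=> sf sg k; apply: Ck_onD. Qed.

Lemma smooth_on_sum (W : normedModType R) n (f : 'I_n -> V -> W) :
  (forall i, smooth_on A (f i)) -> smooth_on A (fun x => \sum_i f i x).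
Proof.
move=> sf; elim: (index_enum _) => [|i s IHs].
  apply: smooth_on_ext (smooth_on_cst 0) => x _; by rewrite big_nil.
apply: smooth_on_ext (smooth_onD (sf i) IHs) => x _.
by rewrite big_cons.
Qed.

Lemma smooth_onM (f g : V -> R) :
  smooth_on A f -> smooth_on A g -> smooth_on A (fun x => f x * g x).
Proof.
move=> sf sg k; elim: k f g sf sg => [|k IHk] f g sf sg.
  move=> x Ax; apply: differentiable_continuous.
  by apply: differentiableM; apply: smooth_on_diff Ax.
have df := smooth_on_diff sf; have dg := smooth_on_diff sg.
split=> [x Ax|v]; first by apply: differentiableM; [apply: df|apply: dg].
have E x : A x -> f x * 'D_v g x + g x * 'D_v f x
                 = 'D_v (fun x => f x * g x) x.
  by move=> Ax; rewrite deriveM//; apply: diff_derivable; [apply: df|apply: dg].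
apply: Ck_on_ext E _.
by apply: Ck_onD; apply: IHk => //; apply: smooth_on_derive.
Qed.

Lemma smooth_onZl (W : normedModType R) (f : V -> R) (c : W) :
  smooth_on A f -> smooth_on A (fun x => f x *: c).
Proof.
move=> sf k; elim: k f sf => [|k IHk] f sf.
  move=> x Ax; apply: differentiable_continuous.
  by apply: differentiableZl; apply: smooth_on_diff Ax.
have df := smooth_on_diff sf.
split=> [x Ax|v]; first by apply: differentiableZl; apply: df.
apply: Ck_on_ext (IHk _ (smooth_on_derive v sf)) => x Ax.
have dfx := df x Ax; have dfcx := differentiableZl c dfx.
by rewrite !deriveE// diffZl.
Qed.

Lemma derive_coord m n (f : V -> 'M[R]_(m, n)) i j x v :
  differentiable f x -> 'D_v (fun y => f y i j) x = 'D_v f x i j.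
Proof.
by move=> /(@diff_derivable _ _ _ _ _ v) df; rewrite derive_mx// mxE.
Qed.

Lemma differentiable_coord_comp m n (f : V -> 'M[R]_(m, n)) i j x :
  differentiable f x -> differentiable (fun y => f y i j) x.
Proof.
move=> df; exact: (differentiable_comp df (differentiable_coord (f x) i j)).
Qed.

Lemma smooth_on_coord m n (f : V -> 'M[R]_(m, n)) i j :
  smooth_on A f -> smooth_on A (fun x => f x i j).
Proof.
move=> sf k; elim: k f sf => [|k IHk] f sf.
  move=> x Ax; apply: differentiable_continuous.
  by apply: differentiable_coord_comp; apply: smooth_on_diff Ax.
have df := smooth_on_diff sf.
split=> [x Ax|v]; first by apply: differentiable_coord_comp; apply: df.
apply: Ck_on_ext (IHk _ (smooth_on_derive v sf)) => x Ax.
by rewrite derive_coord//; apply: df.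
Qed.

(** Going through coordinates reduces this to products of real functions. *)
Lemma smooth_onZ m (f : V -> R) (g : V -> 'rV[R]_m) :
  smooth_on A f -> smooth_on A g -> smooth_on A (fun x => f x *: g x).
Proof.
move=> sf sg.
have s : smooth_on A (fun x => \sum_j (f x * g x 0 j) *: ('e_j : 'rV[R]_m)).
  apply: smooth_on_sum => j; apply: smooth_onZl; apply: smooth_onM => //.
  exact: smooth_on_coord.
apply: smooth_on_ext s => x _.
rewrite [g x in RHS]row_sum_delta scaler_sumr.
by apply: eq_bigr => j _; rewrite scalerA.
Qed.

End Smooth.

(** * Second derivatives *)

Section Directional.
Context {R : realType} {V W : normedModType R}.

Lemma derive_dir (f : V -> W) x a v w : differentiable f x ->
  'D_(a *: v + w) f x = a *: 'D_v f x + 'D_w f x.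
Proof. by move=> df; rewrite !deriveE// linearP. Qed.

Lemma derive_comp (U : normedModType R) (f : U -> V) (g : V -> W) x v :
  differentiable f x -> differentiable g (f x) ->
  'D_v (g \o f) x = 'D_('D_v f x) g (f x).
Proof.
move=> df dg; have dgf := differentiable_comp df dg.
by rewrite (deriveE _ dgf) (deriveE _ df) (deriveE _ dg) diff_comp.
Qed.

Lemma is_derive_line (f : V -> W) x v t : differentiable f (t *: v + x) ->
  is_derive t (1 : R) (fun s : R => f (s *: v + x)) ('D_v f (t *: v + x)).
Proof.
move=> df; pose l (s : R) := s *: v + x.
have did : differentiable (id : R -> R) t by apply: ex_diff.
have dv := differentiableZl v did.
have dl : differentiable l t by apply: differentiableD dv (differentiable_cst _ _).
have dl1 : 'd l t 1 = v.
  have -> : l = (fun s : R => s *: v) + cst x by [].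
  rewrite (diffD dv (differentiable_cst _ _)) /= diff_cst addr0.
  by rewrite (diffZl _ did) diff_val /= scale1r.
have dfl : differentiable (f \o l) t by apply: differentiable_comp.
apply: DeriveDef; first exact: diff_derivable.
by rewrite (deriveE _ dfl) diff_comp//= (deriveE _ df) dl1.
Qed.

End Directional.

Lemma derive_rV (R : realType) m (W : normedModType R) (f : 'rV[R]_m -> W) x v :
  differentiable f x -> 'D_v f x = \sum_j v 0 j *: 'D_('e_j) f x.
Proof.
move=> df; rewrite {1}[v]row_sum_delta deriveE// linear_sum.
by apply: eq_bigr => j _; rewrite linearZ/= deriveE.
Qed.

Section Schwarz.
Context {R : realType} {V : normedModType R}.
Variables (A : set V) (F : V -> R).
Hypotheses (openA : open A) (smF : smooth_on A F).

(** The mean value theorem is applied to s |-> F (s v + r w + x) - F (s v + x),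
    and then to the derivative of F along v, in direction w. *)
Lemma second_difference (x v w : V) (r : R) : 0 < r ->
  (forall s t, 0 <= s <= r -> 0 <= t <= r -> A (s *: v + (t *: w + x))) ->
  exists s t, [/\ 0 <= s <= r, 0 <= t <= r &
    F (r *: v + (r *: w + x)) - F (r *: v + x) - F (r *: w + x) + F x
    = r ^+ 2 * 'D_w ('D_v F) (s *: v + (t *: w + x))].
Proof.
move=> r0 box.
have r00 : 0 <= r <= r by rewrite lexx ltW.
have z0 : 0 <= (0 : R) <= r by rewrite lexx ltW.
have box0 s : 0 <= s <= r -> A (s *: v + x).
  by move=> sr; have := box s 0 sr z0; rewrite scale0r add0r.
pose G s := F (s *: v + (r *: w + x)) - F (s *: v + x).
pose dG s := 'D_v F (s *: v + (r *: w + x)) - 'D_v F (s *: v + x).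
have GD s : 0 <= s <= r -> is_derive s 1 G (dG s).
  move=> sr; apply: is_deriveB; apply: is_derive_line.
    by apply: smooth_on_diff smF _; apply: box.
  by apply: smooth_on_diff smF _; apply: box0.
have contG : {within `[0, r], continuous G}.
  apply: derivable_within_continuous => s; rewrite in_itv/= => sr.
  by have [] := GD s sr.
have GDo s : s \in `]0, r[ -> is_derive s 1 G (dG s).
  by rewrite in_itv/= => /andP[s0 sr]; apply: GD; rewrite !ltW.
have [s s01 sE] := MVT_segment (ltW r0) GDo contG.
rewrite in_itv/= in s01.
pose H t := 'D_v F (t *: w + (s *: v + x)).
pose dH t := 'D_w ('D_v F) (t *: w + (s *: v + x)).
have HD t : 0 <= t <= r -> is_derive t 1 H (dH t).
  move=> tr; apply: is_derive_line.
  apply: smooth_on_diff (smooth_on_derive v smF) _.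
  by rewrite addrCA; apply: box.
have contH : {within `[0, r], continuous H}.
  apply: derivable_within_continuous => t; rewrite in_itv/= => tr.
  by have [] := HD t tr.
have HDo t : t \in `]0, r[ -> is_derive t 1 H (dH t).
  by rewrite in_itv/= => /andP[t0 tr]; apply: HD; rewrite !ltW.
have [t t01 tE] := MVT_segment (ltW r0) HDo contH.
rewrite in_itv/= in t01.
exists s, t; split=> //.
have dGE : dG s = H r - H 0.
  by rewrite /dG /H scale0r add0r addrCA.
rewrite dGE tE /G /dH !scale0r !add0r !subr0 in sE.
rewrite [s *: v + _]addrCA.
have -> (q : R) : r ^+ 2 * q = q * r * r by ring.
by rewrite -sE; ring.
Qed.

(** Symmetry of second derivatives: the second difference is symmetric in the
    two directions, so mixed derivatives agree at points arbitrarily close to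
    x, hence at x by continuity. *)
Lemma derive_schwarz x v w : A x -> 'D_w ('D_v F) x = 'D_v ('D_w F) x.
Proof.
move=> Ax; apply/eqP; rewrite -subr_eq0 -normr_le0; apply/ler_addgt0Pr => e e0.
rewrite add0r.
have cont v1 w1 : \forall y \near x,
    `|'D_w1 ('D_v1 F) x - 'D_w1 ('D_v1 F) y| < e / 2.
  have /cvgrPdist_lt := smooth_on_cont
    (smooth_on_derive w1 (smooth_on_derive v1 smF)) Ax.
  by apply; rewrite divr_gt0.
have nA : nbhs x A by apply: open_nbhs_nbhs; split.
have := filterI nA (filterI (cont v w) (cont w v)).
move=> /(_ _ _)/nbhs_ballP[d /= d0 ball_d].
(* the box of side r spanned by v and w at x lies in the ball of radius d; the
   summand 1 only keeps the denominator positive *)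
pose r := d / (`|v| + `|w| + 1).
have den0 : 0 < `|v| + `|w| + 1 by rewrite ltr_wpDl// addr_ge0.
have r0 : 0 < r by rewrite divr_gt0.
have inball v1 w1 s t : `|v1| + `|w1| = `|v| + `|w| -> 0 <= s <= r ->
    0 <= t <= r -> ball x d (s *: v1 + (t *: w1 + x)).
  move=> vw /andP[s0 sr] /andP[t0 tr].
  rewrite -ball_normE /ball_ /= addrA opprD addrCA subrr addr0 normrN.
  apply: le_lt_trans (ler_normD _ _) _; rewrite !normrZ !ger0_norm//.
  apply: (@le_lt_trans _ _ (r * (`|v| + `|w|))).
    by rewrite -vw mulrDr lerD// ler_wpM2r.
  by rewrite /r -mulrA -[X in _ < X]mulr1 ltr_pM2l// mulrC ltr_pdivrMr// mul1r ltrDl.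
have [s [t [s01 t01 E1]]] := second_difference r0
  (fun s t sr tr => let: conj a _ := ball_d _ (inball v w s t erefl sr tr) in a).
have wv : `|w| + `|v| = `|v| + `|w| by rewrite addrC.
have [s' [t' [s01' t01' E2]]] := second_difference r0
  (fun s t sr tr => let: conj a _ := ball_d _ (inball w v s t wv sr tr) in a).
have E : 'D_w ('D_v F) (s *: v + (t *: w + x))
       = 'D_v ('D_w F) (s' *: w + (t' *: v + x)).
  have r2 : r ^+ 2 != 0 by rewrite expf_neq0 ?gt_eqF.
  apply: (mulfI r2); apply: (etrans (esym E1)); apply: (etrans _ E2).
  by rewrite [r *: w + (_ + _)]addrCA; congr (_ + _); rewrite addrAC.
have [_ [close1 _]] := ball_d _ (inball v w s t erefl s01 t01).
have [_ [_ close2]] := ball_d _ (inball w v s' t' wv s01' t01').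
rewrite E in close1; rewrite (splitr e).
apply: (le_trans (ler_distD ('D_v ('D_w F) (s' *: w + (t' *: v + x))) _ _)).
rewrite distrC in close2.
exact: (lerD (ltW close1) (ltW close2)).
Qed.

End Schwarz.

Section VaryingDirection.
Context {R : realType} {m : nat}.
Variables (A : set 'rV[R]_m) (Y : 'rV[R]_m -> 'rV[R]_m).
Hypotheses (openA : open A) (smY : smooth_on A Y).

Lemma smooth_on_derive_dir (F : 'rV[R]_m -> R) :
  smooth_on A F -> smooth_on A (fun u => 'D_(Y u) F u).
Proof.
move=> smF.
have : smooth_on A (fun u => \sum_j Y u 0 j * 'D_('e_j) F u).
  apply: smooth_on_sum => // j; apply: smooth_onM => //.
    exact: smooth_on_coord.
  exact: smooth_on_derive.
apply: smooth_on_ext => // u Au.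
by rewrite [RHS]derive_rV//; apply: smooth_on_diff smF Au.
Qed.

(** The product rule for u |-> dF_u (Y u). The last term carries the second
    derivative of F, written by symmetry as a derivative along the fixed vector
    Y x, so that it can be compared for two vector fields. *)
Lemma derive_derive_dir (F : 'rV[R]_m -> R) x v : smooth_on A F -> A x ->
  'D_v (fun u => 'D_(Y u) F u) x = 'D_('D_v Y x) F x + 'D_(Y x) ('D_v F) x.
Proof.
move=> smF Ax; have dF := smooth_on_diff smF Ax.
have dY := smooth_on_diff smY Ax.
have dDF w := smooth_on_diff (smooth_on_derive w smF) Ax.
rewrite (derive_rV ('D_v Y x) dF) (derive_rV (Y x) (dDF v)).
rewrite (@near_eq_derive _ _ _ _ (\sum_j (fun u => Y u 0 j) * 'D_('e_j) F)).
  have dYj j := differentiable_coord_comp 0 j dY.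
  rewrite derive_sum; last first.
    move=> j; apply: derivableM; apply: diff_derivable; first exact: dYj.
    exact: dDF.
  rewrite -big_split/=; apply: eq_bigr => j _.
  rewrite deriveM; [|exact: diff_derivable (dYj j)|exact: diff_derivable (dDF _)].
  rewrite derive_coord// (derive_schwarz openA smF _ _ Ax) addrC.
  by congr (_ + _); exact: mulrC.
apply: (near_open openA Ax) => u Au.
rewrite (derive_rV _ (smooth_on_diff smF Au)) fct_sumE.
by apply: eq_bigr.
Qed.

End VaryingDirection.

(** * Vector fields on a manifold *)

Section ManifoldCalculus.
Context {R : realType} {m : nat}.
Variable M : manifold R m.
Implicit Types (X Y : vfield M) (f k : M -> R) (p q : M).

Lemma chart_dom p q : dom p q -> (chart p @` dom p) (chart p q).
Proof. by move=> pq; exists q. Qed.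

Lemma chart_center p : (chart p @` dom p) (chart p p).
Proof. exact/chart_dom/dom_mem. Qed.

Lemma nbhs_chart_center p : nbhs (chart p p) (chart p @` dom p).
Proof.
apply: open_nbhs_nbhs; split; [exact: chart_open|exact: chart_center].
Qed.

Lemma paramK p u : (chart p @` dom p) u -> chart p (param p u) = u.
Proof. by case=> q pq <-; rewrite chartK. Qed.

Lemma param_dom p u : (chart p @` dom p) u -> dom p (param p u).
Proof. by case=> q pq <-; rewrite chartK. Qed.

Lemma transition_diff p q : dom p q ->
  differentiable (chart p \o param q) (chart q q).
Proof.
move=> pq; apply: smooth_on_diff (@transition_smooth _ _ M q p) _.
by exists q => //; split=> //; exact: dom_mem.
Qed.

Lemma smooth_fun_diff (f : M -> R) p u : smooth_fun f ->
  (chart p @` dom p) u -> differentiable (f \o param p) u.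
Proof. by move=> sf; apply: smooth_on_diff (sf p). Qed.

Lemma lie_deriv_chart_center X p : lie_deriv X (chart p) p = X p.
Proof.
rewrite /lie_deriv (@near_eq_derive _ _ _ _ id); first exact: derive_id.
by apply: filterS (nbhs_chart_center p) => u; exact: paramK.
Qed.

(** A tangent vector at q is given in the chart at q; this is the chain rule for
    the transition to the chart at p. With one chart for all q near p, the
    function X f becomes an ordinary derivative in a varying direction. *)
Lemma lie_deriv_chart X f p q : smooth_fun f -> dom p q ->
  lie_deriv X f q = 'D_(lie_deriv X (chart p) q) (f \o param p) (chart p q).
Proof.
move=> sf pq; have cq : (chart q @` dom q) (chart q q) := chart_center q.
have E : (chart p \o param q) (chart q q) = chart p q.
  by rewrite /= chartK//; exact: dom_mem.
have df : differentiable (f \o param p) ((chart p \o param q) (chart q q)).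
  by rewrite E; apply: smooth_fun_diff sf (chart_dom pq).
rewrite {2}/lie_deriv -[in RHS]E -(derive_comp _ (transition_diff pq) df).
apply: near_eq_derive.
have np : nbhs (chart q q) (param q @^-1` dom p).
  apply: (param_continuous cq); rewrite chartK; last exact: dom_mem.
  by apply: open_nbhs_nbhs; split=> //; exact: dom_open.
by apply: filterS np => u /= pu; rewrite chartK.
Qed.

Lemma lie_deriv_param X f p u : smooth_fun f -> (chart p @` dom p) u ->
  lie_deriv X f (param p u)
  = 'D_((lie_deriv X (chart p) \o param p) u) (f \o param p) u.
Proof.
move=> sf pu; rewrite (lie_deriv_chart _ sf (param_dom pu)).
by rewrite (paramK pu).
Qed.

Lemma smooth_lie_deriv X f : smooth_vfield X -> smooth_fun f ->
  smooth_fun (lie_deriv X f).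
Proof.
move=> sX sf p; have oU := @chart_open _ _ M p.
have s := smooth_on_derive_dir oU (sX p) (sf p).
by apply: (smooth_on_ext oU _ s) => u pu /=; rewrite (lie_deriv_param _ sf pu).
Qed.

(** By the product rule, X (Y f) is the derivative of f along X (Y^i), plus a
    second derivative of f that is symmetric in X and Y and so cancels. *)
Lemma lie_deriv_bracket X Y f p : smooth_vfield X -> smooth_vfield Y ->
  smooth_fun f ->
  lie_deriv (lie_bracket X Y) f p
  = lie_deriv X (lie_deriv Y f) p - lie_deriv Y (lie_deriv X f) p.
Proof.
move=> sX sY sf; have oU := @chart_open _ _ M p; have cU := chart_center p.
have second Z W : smooth_vfield W -> lie_deriv Z (lie_deriv W f) p
    = 'D_(lie_deriv Z (lie_deriv W (chart p)) p) (f \o param p) (chart p p)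
      + 'D_(W p) ('D_(Z p) (f \o param p)) (chart p p).
  move=> sW; have := derive_derive_dir oU (sW p) (Z p) (sf p) cU.
  rewrite /= chartK ?lie_deriv_chart_center; last exact: dom_mem.
  move=> <-; rewrite {1}/lie_deriv; apply: near_eq_derive.
  by apply: filterS (nbhs_chart_center p) => u; exact: lie_deriv_param.
have schwarz := derive_schwarz oU (sf p) (Y p) (X p) cU.
have cancel (a b c d : R) : c = d -> a + c - (b + d) = a - b by move=> ->; ring.
rewrite (second _ _ sX) (second _ _ sY) (cancel _ _ _ _ (esym schwarz)).
have df := smooth_fun_diff sf cU.
rewrite {1}/lie_deriv /lie_bracket addrC -scaleN1r (derive_dir _ _ _ df).
by rewrite scaleN1r addrC.
Qed.

Lemma smooth_fun_cst (c : R) : smooth_fun (fun _ : M => c).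
Proof. by move=> p; apply: (smooth_on_cst (@chart_open _ _ M p)). Qed.

Lemma smooth_funM f k : smooth_fun f -> smooth_fun k ->
  smooth_fun (fun p => f p * k p).
Proof.
by move=> sf sk p; apply: (smooth_onM (@chart_open _ _ M p) (sf p) (sk p)).
Qed.

Lemma smooth_funN f : smooth_fun f -> smooth_fun (fun p => - f p).
Proof.
move=> sf; rewrite (_ : (fun p => _) = fun p => -1 * f p); last first.
  by apply/funext => p; rewrite mulN1r.
exact: smooth_funM (smooth_fun_cst _) sf.
Qed.

Lemma lie_deriv_cst X (c : R) p : lie_deriv X (fun=> c) p = 0.
Proof. exact: derive_cst. Qed.

Lemma smooth_vfield0 : smooth_vfield (fun _ : M => 0).
Proof.
move=> p; apply: (smooth_on_ext (@chart_open _ _ M p) _ (smooth_on_cst (@chart_open _ _ M p) 0)).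
by move=> u _; rewrite /= /lie_deriv derive0.
Qed.

Lemma smooth_vfield_comb f X Y : smooth_fun f -> smooth_vfield X ->
  smooth_vfield Y -> smooth_vfield (fun p => f p *: X p + Y p).
Proof.
move=> sf sX sY p; have oU := @chart_open _ _ M p.
have s := smooth_onD oU (smooth_onZ oU (sf p) (sX p)) (sY p).
apply: (smooth_on_ext oU _ s) => u pu /=; rewrite {3}/lie_deriv.
by rewrite (derive_dir _ _ _ (transition_diff (param_dom pu))).
Qed.

Lemma smooth_vfieldD X Y : smooth_vfield X -> smooth_vfield Y ->
  smooth_vfield (fun p => X p + Y p).
Proof.
move=> sX sY; have := smooth_vfield_comb (smooth_fun_cst 1) sX sY.
by rewrite (_ : (fun p => _) = fun p => X p + Y p)//; apply/funext => p; rewrite scale1r.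
Qed.

Lemma smooth_vfieldZ f X : smooth_fun f -> smooth_vfield X ->
  smooth_vfield (fun p => f p *: X p).
Proof.
move=> sf sX; have := smooth_vfield_comb sf sX smooth_vfield0.
by rewrite (_ : (fun p => _) = fun p => f p *: X p)//; apply/funext => p; rewrite addr0.
Qed.

Lemma smooth_vfieldB X Y : smooth_vfield X -> smooth_vfield Y ->
  smooth_vfield (fun p => X p - Y p).
Proof.
move=> sX sY; have := smooth_vfield_comb (smooth_fun_cst (-1)) sY sX.
rewrite (_ : (fun p => _) = fun p => X p - Y p)//; apply/funext => p.
by rewrite scaleN1r addrC.
Qed.

End ManifoldCalculus.

(** * Torsion-free connections *)

Section Connections.
Context {R : realType} {m : nat}.
Variable M : manifold R m.
Implicit Types (X Y Z E : vfield M) (f : M -> R) (p : M).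

(** A torsion-free affine connection: what the Levi-Civita and the Weyl connection
    have in common. *)
Record connection (D : vfield M -> vfield M -> vfield M) : Prop := Connection {
  conn_smooth : forall X Y, smooth_vfield X -> smooth_vfield Y ->
    smooth_vfield (D X Y);
  conn_linear_l : forall f X X' Y, smooth_fun f ->
    smooth_vfield X -> smooth_vfield X' -> smooth_vfield Y ->
    D (fun p => f p *: X p + X' p) Y = (fun p => f p *: D X Y p + D X' Y p);
  conn_leibniz_r : forall f X Y Y', smooth_fun f ->
    smooth_vfield X -> smooth_vfield Y -> smooth_vfield Y' ->
    D X (fun p => f p *: Y p + Y' p)
    = (fun p => f p *: D X Y p + lie_deriv X f p *: Y p + D X Y' p);
  conn_torsion_free : forall X Y, smooth_vfield X -> smooth_vfield Y ->
    lie_bracket X Y = (fun p => D X Y p - D Y X p)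
}.

Lemma levi_civita_connection g nabla :
  levi_civita g nabla -> connection nabla.
Proof.
case=> s l lr t _; split=> // X Y sX sY.
by apply/funext => p; rewrite t.
Qed.

(** The terms added to the Levi-Civita connection are tensorial and symmetric in X
    and Y. *)
Lemma weyl_connection g nabla E : riemannian_metric g -> levi_civita g nabla ->
  smooth_vfield E -> connection (weyl g nabla E).
Proof.
move=> [gP gs] LC sE; have [ns nl nr nt] := levi_civita_connection LC.
split.
- move=> X Y sX sY; apply: smooth_vfieldB.
    apply: smooth_vfieldD; last exact: smooth_vfieldZ (gs _ _ sE sX) sY.
    by apply: smooth_vfieldD; [exact: ns|exact: smooth_vfieldZ (gs _ _ sE sY) sX].
  exact: smooth_vfieldZ (gs _ _ sX sY) sE.
- move=> f X X' Y sf sX sX' sY; apply/funext => p; rewrite /weyl nl//.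
  rewrite /pairing !(spDl (gP p), spDr (gP p), spZl (gP p), spZr (gP p)).
  by apply/rowP => j; rewrite !mxE; ring.
- move=> f X Y Y' sf sX sY sY'; apply/funext => p; rewrite /weyl nr//.
  rewrite /pairing !(spDl (gP p), spDr (gP p), spZl (gP p), spZr (gP p)).
  by apply/rowP => j; rewrite !mxE; ring.
- move=> X Y sX sY; rewrite nt//; apply/funext => p; rewrite /weyl.
  rewrite /pairing (spC (gP p) (Y p) (X p)).
  by apply/rowP => j; rewrite !mxE; ring.
Qed.

Section Tensoriality.
Variable D : vfield M -> vfield M -> vfield M.
Hypothesis connD : connection D.

Let Ds := conn_smooth connD.
Let Dl := conn_linear_l connD.
Let Dr := conn_leibniz_r connD.

Lemma smooth_lie_bracket X Y : smooth_vfield X -> smooth_vfield Y ->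
  smooth_vfield (lie_bracket X Y).
Proof.
move=> sX sY; rewrite (conn_torsion_free connD sX sY).
by apply: smooth_vfieldB; apply: Ds.
Qed.

(** As [X, Y] = D_X Y - D_Y X, this follows from the two rules of the connection,
    without differentiating components. *)
Lemma lie_bracket_linear_l f X X' Y : smooth_fun f -> smooth_vfield X ->
  smooth_vfield X' -> smooth_vfield Y ->
  lie_bracket (fun p => f p *: X p + X' p) Y
  = (fun p => f p *: lie_bracket X Y p +
              ((- lie_deriv Y f p) *: X p + lie_bracket X' Y p)).
Proof.
move=> sf sX sX' sY; have t := conn_torsion_free connD.
rewrite (t _ _ (smooth_vfield_comb sf sX sX') sY) (t _ _ sX sY) (t _ _ sX' sY).
rewrite (Dl sf sX sX' sY) (Dr sf sY sX sX'); apply/funext => p.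
have cancel (c d : R) (u v x w y : 'rV[R]_m) :
    c *: u + x - (c *: v + d *: w + y) = c *: (u - v) + (- d *: w + (x - y)).
  by apply/rowP => j; rewrite !mxE; ring.
exact: cancel.
Qed.

(** The term (Y f) D_X Z of D_Y (f D_X Z) cancels against the one that comes from
    the bracket. *)
Lemma curvature_linear1 f X X' Y Z p : smooth_fun f -> smooth_vfield X ->
  smooth_vfield X' -> smooth_vfield Y -> smooth_vfield Z ->
  curvature D (fun p => f p *: X p + X' p) Y Z p
  = f p *: curvature D X Y Z p + curvature D X' Y Z p.
Proof.
move=> sf sX sX' sY sZ; rewrite /curvature (lie_bracket_linear_l sf sX sX' sY).
have sYf : smooth_fun (fun p => - lie_deriv Y f p).
  exact/smooth_funN/smooth_lie_deriv.
have sb := smooth_lie_bracket sX sY; have sb' := smooth_lie_bracket sX' sY.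
rewrite (Dl sf sb (smooth_vfield_comb sYf sX sb') sZ) (Dl sYf sX sb' sZ).
rewrite (Dl sf sX sX' (Ds sY sZ)) (Dl sf sX sX' sZ).
rewrite (Dr sf sY (Ds sX sZ) (Ds sX' sZ)).
have cancel (c d : R) (u v w x y z e : 'rV[R]_m) :
    c *: u + x - (c *: v + d *: e + y) - (c *: w + (- d *: e + z))
    = c *: (u - v - w) + (x - y - z).
  by apply/rowP => j; rewrite !mxE; ring.
exact: cancel.
Qed.

Lemma curvature_swap X Y Z p : smooth_vfield X -> smooth_vfield Y ->
  smooth_vfield Z -> curvature D X Y Z p = - curvature D Y X Z p.
Proof.
move=> sX sY sZ; rewrite /curvature.
have sb := smooth_lie_bracket sY sX.
have -> : lie_bracket X Y = (fun p => -1 *: lie_bracket Y X p + 0).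
  apply/funext => q; rewrite (conn_torsion_free connD sX sY).
  by rewrite (conn_torsion_free connD sY sX) scaleN1r opprB addr0.
have s0 : smooth_vfield (fun _ : M => (0 : 'rV[R]_m)) by apply: smooth_vfield0.
rewrite (Dl (smooth_fun_cst (-1)) sb s0 sZ).
have D0 : D (fun=> 0) Z p = 0.
  have := Dl (smooth_fun_cst 1) s0 s0 sZ.
  move=> /(congr1 (fun V => V p)); rewrite (_ : (fun p => _) = fun=> 0).
    by rewrite scale1r => /eqP; rewrite -subr_eq0 opprD addrA subrr add0r oppr_eq0 => /eqP.
  by apply/funext => q; rewrite scaler0 addr0.
rewrite D0; have cancel (u v w : 'rV[R]_m) :
    u - v - (-1 *: w + 0) = - (v - u - w).
  by apply/rowP => j; rewrite !mxE; ring.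
exact: cancel.
Qed.

(** The first derivatives of f cancel in pairs, and the remaining terms are
    (X (Y f) - Y (X f) - [X, Y] f) Z = 0. *)
Lemma curvature_linear3 f X Y Z Z' p : smooth_fun f -> smooth_vfield X ->
  smooth_vfield Y -> smooth_vfield Z -> smooth_vfield Z' ->
  curvature D X Y (fun p => f p *: Z p + Z' p) p
  = f p *: curvature D X Y Z p + curvature D X Y Z' p.
Proof.
move=> sf sX sY sZ sZ'; rewrite /curvature.
have sXf := smooth_lie_deriv sX sf; have sYf := smooth_lie_deriv sY sf.
have sb := smooth_lie_bracket sX sY.
have assoc U V : (fun p => f p *: D U Z p + lie_deriv V f p *: Z p + D U Z' p)
    = (fun p => f p *: D U Z p + (lie_deriv V f p *: Z p + D U Z' p)).
  by apply/funext => q; rewrite addrA.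
rewrite (Dr sf sY sZ sZ') (Dr sf sX sZ sZ') (Dr sf sb sZ sZ') !assoc.
rewrite (Dr sf sX (Ds sY sZ) (smooth_vfield_comb sYf sZ (Ds sY sZ'))).
rewrite (Dr sf sY (Ds sX sZ) (smooth_vfield_comb sXf sZ (Ds sX sZ'))).
rewrite (Dr sYf sX sZ (Ds sY sZ')) (Dr sXf sY sZ (Ds sX sZ')).
rewrite (lie_deriv_bracket _ sX sY sf).
have cancel (c d e b b' : R) (u v w x y z dX dY k : 'rV[R]_m) :
    c *: u + d *: dY + (e *: dX + b *: k + x)
      - (c *: v + e *: dX + (d *: dY + b' *: k + y))
      - (c *: w + (b - b') *: k + z)
    = c *: (u - v - w) + (x - y - z).
  by apply/rowP => j; rewrite !mxE; ring.
exact: cancel.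
Qed.

End Tensoriality.

Section Frame.
Variables (I : Type) (s : seq I) (B : I -> vfield M) (phi : I -> vfield M -> M -> R).
Hypotheses (smB : forall i, smooth_vfield (B i))
  (smphi : forall i X, smooth_vfield X -> smooth_fun (phi i X))
  (phi_local : forall i X X' p, X p = X' p -> phi i X p = phi i X' p)
  (frame : forall X p, X p = \sum_(i <- s) phi i X p *: B i p).

(** Expanding X in the frame gives T X = \sum_i phi i X p *: T (B i), where only
    the values at p of the coordinates of X enter. *)
Lemma tensorial_local (T : vfield M -> 'rV[R]_m) p :
  (forall f X X', smooth_fun f -> smooth_vfield X -> smooth_vfield X' ->
     T (fun q => f q *: X q + X' q) = f p *: T X + T X') ->
  forall X X', smooth_vfield X -> smooth_vfield X' -> X p = X' p -> T X = T X'.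
Proof.
move=> Tl.
have s0 : smooth_vfield (fun _ : M => (0 : 'rV[R]_m)) by apply: smooth_vfield0.
have T0 : T (fun=> 0) = 0.
  have := Tl _ _ _ (smooth_fun_cst 1) s0 s0.
  rewrite (_ : (fun q => _) = fun=> 0); last first.
    by apply/funext => q; rewrite scaler0 addr0.
  by rewrite scale1r => /eqP; rewrite -subr_eq0 opprD addrA subrr add0r oppr_eq0 => /eqP.
have expand X : smooth_vfield X -> T X = \sum_(i <- s) phi i X p *: T (B i).
  move=> sX; have -> : X = (fun q => \sum_(i <- s) phi i X q *: B i q).
    by apply/funext => q; apply: frame.
  rewrite [in RHS](_ : (fun q => _) = X); last first.
    by apply/funext => q; rewrite -frame.
  suff [] : smooth_vfield (fun q => \sum_(i <- s) phi i X q *: B i q) /\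
     T (fun q => \sum_(i <- s) phi i X q *: B i q)
     = \sum_(i <- s) phi i X p *: T (B i) by [].
  elim: (s) => [|i r [sr IHr]].
    have -> : (fun q => \sum_(i <- [::]) phi i X q *: B i q) = fun=> 0.
      by apply/funext => q; rewrite big_nil.
    by split; [exact: s0|rewrite big_nil].
  rewrite big_cons (_ : (fun q => _) =
    fun q => phi i X q *: B i q + \sum_(j <- r) phi j X q *: B j q); last first.
    by apply/funext => q; rewrite big_cons.
  split; first exact: smooth_vfield_comb (smphi i sX) (smB i) sr.
  by rewrite (Tl _ _ _ (smphi i sX) (smB i) sr) IHr.
move=> X X' sX sX' XX'; rewrite !expand//.
by apply: eq_bigr => i _; rewrite (phi_local _ XX').
Qed.

(** The three arguments are replaced one at a time; the second one is moved to the
    first slot by antisymmetry. *)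
Lemma curvature_local D X Y X' Y' p : connection D ->
  smooth_vfield X -> smooth_vfield X' -> smooth_vfield Y -> smooth_vfield Y' ->
  X p = X' p -> Y p = Y' p -> curvature D X Y Y p = curvature D X' Y' Y' p.
Proof.
move=> cD sX sX' sY sY' XX' YY'.
have -> : curvature D X Y Y p = curvature D X' Y Y p.
  apply: (tensorial_local (T := fun V => curvature D V Y Y p) _ sX sX' XX').
  by move=> f U U' sf sU sU'; exact: (curvature_linear1 cD).
have -> : curvature D X' Y Y p = curvature D X' Y' Y p.
  have E : curvature D Y X' Y p = curvature D Y' X' Y p.
    apply: (tensorial_local (T := fun V => curvature D V X' Y p) _ sY sY' YY').
    by move=> f U U' sf sU sU'; exact: (curvature_linear1 cD).
  rewrite (curvature_swap cD p sX' sY sY) E.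
  exact: esym (curvature_swap cD p sX' sY' sY).
apply: (tensorial_local (T := fun V => curvature D X' Y' V p) _ sY sY' YY').
by move=> f U U' sf sU sU'; exact: (curvature_linear3 cD).
Qed.

End Frame.

End Connections.

(** * A basis of the extended Lie algebra and its dual basis *)

Section ExtensionBasis.
Context {R : realType} {n : nat}.
Variable ip : ext_alg R n -> ext_alg R n -> R.
Hypothesis ipP : scalar_product ip.

Definition ext_of_row (c : 'rV[R]_(1 + n)) : ext_alg R n :=
  (lsubmx c 0 0, rsubmx c).

Definition row_of_ext (x : ext_alg R n) : 'rV[R]_(1 + n) :=
  row_mx (x.1)%:M x.2.

Lemma row_of_extK x : ext_of_row (row_of_ext x) = x.
Proof.
by case: x => s u; rewrite /ext_of_row row_mxKl row_mxKr mxE eqxx mulr1n.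
Qed.

Lemma ext_of_rowK c : row_of_ext (ext_of_row c) = c.
Proof.
rewrite /row_of_ext /ext_of_row /= -[RHS]hsubmxK; congr row_mx.
by apply/rowP => j; rewrite !ord1 mxE eqxx mulr1n.
Qed.

Definition ext_basis (i : 'I_(1 + n)) : ext_alg R n := ext_of_row 'e_i.

Lemma ext_of_row_sum c : ext_of_row c = \sum_i c 0 i *: ext_basis i.
Proof.
have lin : linear ext_of_row.
  move=> a u v; rewrite /ext_of_row; apply: injective_projections => /=.
    by rewrite !mxE.
  by apply/rowP => j; rewrite !mxE.
pose f : {linear 'rV[R]_(1 + n) -> ext_alg R n} :=
  HB.pack ext_of_row (GRing.isLinear.Build _ _ _ _ _ lin).
rewrite {1}[c]row_sum_delta -[ext_of_row]/(f : _ -> _) linear_sum.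
by apply: eq_bigr => i _; rewrite linearZ.
Qed.

Lemma ext_of_row_eq0 c : ext_of_row c = 0 -> c = 0.
Proof.
have e0 : ext_of_row 0 = 0.
  by rewrite ext_of_row_sum; apply: big1 => i _; rewrite mxE scale0r.
by move=> c0; rewrite -[c]ext_of_rowK c0 -e0 ext_of_rowK.
Qed.

Definition gram : 'M[R]_(1 + n) := \matrix_(i, j) ip (ext_basis i) (ext_basis j).

Definition dual_basis (i : 'I_(1 + n)) : ext_alg R n :=
  \sum_j invmx gram j i *: ext_basis j.

(** The Gram matrix is invertible because the scalar product is definite. *)
Lemma dual_basisP x : x = \sum_i ip x (dual_basis i) *: ext_basis i.
Proof.
have mul_gram c j : (c *m gram) 0 j = ip (ext_of_row c) (ext_basis j).
  rewrite ext_of_row_sum (sp_suml ipP) mxE; apply: eq_bigr => i _.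
  by rewrite mxE (spZl ipP).
have Gu : gram \in unitmx.
  rewrite -row_free_unit; apply: inj_row_free => c c0.
  apply: ext_of_row_eq0.
  apply: (sp_eq0 ipP); rewrite {2}ext_of_row_sum (sp_sumr ipP).
  apply: big1 => j _; rewrite (spZr ipP) -mul_gram c0 mxE.
  by rewrite mulr0.
rewrite -[x in LHS]row_of_extK ext_of_row_sum; apply: eq_bigr => i _.
congr (_ *: _); rewrite -[row_of_ext x](mulmxK Gu) mxE /dual_basis (sp_sumr ipP).
by apply: eq_bigr => j _; rewrite mul_gram row_of_extK (spZr ipP) mulrC.
Qed.

End ExtensionBasis.

(** * Left invariant fields *)

Section Group.
Context {R : realType} {m : nat}.
Variable S : lie_group R m.

Lemma gmulVr (x : S) : gmul x (ginv x) = gone S.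
Proof.
rewrite -(gmul1 (gmul x (ginv x))) -{1}(gmulV (ginv x)) -gmulA.
by rewrite (gmulA (ginv x)) gmulV gmul1 gmulV.
Qed.

Lemma gmul1r (x : S) : gmul x (gone S) = x.
Proof. by rewrite -(gmulV x) gmulA gmulVr gmul1. Qed.

End Group.

Section LeftInvariant.
Context {R : realType} {n : nat}.
Variables (S : lie_group R n.+1) (br : ext_alg R n -> ext_alg R n -> ext_alg R n).
Variables (iota : ext_alg R n -> vfield S) (ip : ext_alg R n -> ext_alg R n -> R).
Variable g : S -> 'rV[R]_n.+1 -> 'rV[R]_n.+1 -> R.
Hypotheses (hiota : lie_algebra_iso br iota) (ipP : scalar_product ip)
  (hg : left_invariant_metric ip iota g).

Lemma smooth_iota x : smooth_vfield (iota x).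
Proof. by case: (iota_left_invariant hiota x). Qed.

(** Left translation by p carries the unit element to p, the left invariant fields
    to themselves, and preserves the metric. *)
Lemma metric_iota p x y : g p (iota x p) (iota y p) = ip x y.
Proof.
case: hg => _ inv one; rewrite -one -(inv p (gone S)).
have [_ lx] := iota_left_invariant hiota x.
have [_ ly] := iota_left_invariant hiota y.
by rewrite lx ly gmul1r.
Qed.

Lemma left_inv0 p : iota 0 p = 0.
Proof.
by have := iota_linear hiota (-1) 0 0 p; rewrite scaler0 addr0 scaleN1r addNr.
Qed.

Lemma left_inv_add x y p : iota (x + y) p = iota x p + iota y p.
Proof. by rewrite -[x]scale1r (iota_linear hiota) !scale1r. Qed.

Lemma left_inv_scale a x p : iota (a *: x) p = a *: iota x p.
Proof. by rewrite -[a *: x]addr0 (iota_linear hiota) left_inv0 addr0. Qed.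

Lemma left_inv_sub x y p : iota (x - y) p = iota x p - iota y p.
Proof. by rewrite -scaleN1r left_inv_add left_inv_scale scaleN1r. Qed.

Lemma left_inv_sum p I (s : seq I) (F : I -> ext_alg R n) :
  iota (\sum_(i <- s) F i) p = \sum_(i <- s) iota (F i) p.
Proof. by elim/big_rec2: _ => [|i y x _ <-]; rewrite ?left_inv0 ?left_inv_add. Qed.

(** The map x |-> iota x p is injective, because it preserves the scalar product,
    and both spaces have dimension n + 1. *)
Lemma iota_surj_at p v : exists x, v = iota x p.
Proof.
pose A : 'M[R]_(1 + n, n.+1) := \matrix_i iota (ext_basis i) p.
have mulA c : c *m A = iota (ext_of_row c) p.
  rewrite ext_of_row_sum left_inv_sum mulmx_sum_row; apply: eq_bigr => i _.
  by rewrite rowK left_inv_scale.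
have Afree : row_free A.
  apply: inj_row_free => c; rewrite mulA => c0.
  apply/ext_of_row_eq0/(sp_eq0 ipP).
  by rewrite -(metric_iota p) c0; case: hg => -[gP _] _ _; rewrite (sp0l (gP p)).
exists (ext_of_row (v *m invmx A)); rewrite -mulA mulmxKV//.
by rewrite -row_free_unit.
Qed.

Lemma metric_iota_inj p v w :
  (forall z, g p v (iota z p) = g p w (iota z p)) -> v = w.
Proof.
case: hg => -[gP _] _ _ vw; apply: (sp_inj (gP p)) => u.
by have [z ->] := iota_surj_at p u.
Qed.

Lemma pairing_iota x y : pairing g (iota x) (iota y) = (fun=> ip x y).
Proof. by apply/funext => p; apply: metric_iota. Qed.

(** The Koszul formula without its derivative terms: scalar products of left
    invariant fields are constant. *)
Lemma koszul_left_invariant nabla x y z p : levi_civita g nabla ->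
  2 * g p (nabla (iota x) (iota y) p) (iota z p)
  = ip (br x y) z - ip (br y z) x + ip (br z x) y.
Proof.
move=> LC; have [[gP gs] _ _] := hg.
pose a u v w := g p (nabla (iota u) (iota v) p) (iota w p).
have askew u v w : a u v w = - a u w v.
  have := lc_metric LC (smooth_iota u) (smooth_iota v) (smooth_iota w) p.
  rewrite pairing_iota lie_deriv_cst (spC (gP p) (iota v p)) => /esym/eqP.
  by rewrite addr_eq0 => /eqP.
have ators u v w : a u v w - a v u w = ip (br u v) w.
  rewrite /a -(spBl (gP p)).
  rewrite (lc_torsion_free LC (smooth_iota u) (smooth_iota v)).
  by rewrite -(iota_bracket hiota) metric_iota.
rewrite -/(a x y z) -!ators (askew y x z) (askew z y x) (askew x z y).
by rewrite (askew y z x) (askew z x y); ring.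
Qed.

Lemma iota_frame (X : vfield S) p :
  X p = \sum_i pairing g X (iota (dual_basis ip i)) p *: iota (ext_basis i) p.
Proof.
have [x Xx] := iota_surj_at p (X p).
rewrite Xx {1}(dual_basisP ipP x) left_inv_sum; apply: eq_bigr => i _.
by rewrite left_inv_scale /pairing Xx metric_iota.
Qed.

(** The left invariant fields are the global frame that [curvature_local]
    requires, and the dual basis provides smooth coordinates in it. *)
Lemma curvature_left_invariant D x y (X Y : vfield S) p : connection D ->
  smooth_vfield X -> smooth_vfield Y -> X p = iota x p -> Y p = iota y p ->
  curvature D X Y Y p = curvature D (iota x) (iota y) (iota y) p.
Proof.
move=> cD sX sY Xp Yp; have [[_ gs] _ _] := hg.
pose phi i (Z : vfield S) := pairing g Z (iota (dual_basis ip i)).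
have smB (i : 'I_(1 + n)) : smooth_vfield (iota (ext_basis i)).
  exact: smooth_iota.
have smphi i Z : smooth_vfield Z -> smooth_fun (phi i Z).
  by move=> sZ; exact: gs sZ (smooth_iota _).
have phi_local i Z Z' q : Z q = Z' q -> phi i Z q = phi i Z' q.
  by move=> ZZ'; rewrite /phi /pairing ZZ'.
exact: (curvature_local smB smphi phi_local iota_frame cD sX (smooth_iota x)
  sY (smooth_iota y) Xp Yp).
Qed.

End LeftInvariant.

Local Close Scope classical_set_scope.

(** * Weyl curvature of the extended Lie algebra *)

Section ExtensionCurvature.
Context {R : realType} {n : nat}.
Variable L : {linear 'rV[R]_n -> 'rV[R]_n}.
Variable ip : ext_alg R n -> ext_alg R n -> R.
Hypotheses (ipP : scalar_product ip) (hb : ip ext_b ext_b = 1)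
  (hbu : forall u : 'rV[R]_n, ip ext_b (ext_incl u) = 0).
Hypothesis hL : forall u v : 'rV[R]_n,
  ip (ext_incl (L u)) (ext_incl v) = ip (ext_incl u) (ext_incl (L v)).

Definition sp_incl (u v : 'rV[R]_n) : R := ip (ext_incl u) (ext_incl v).
Local Notation h := sp_incl.

Lemma sp_incl_scalar_product : scalar_product h.
Proof.
have inclP a u v : ext_incl (a *: u + v) = a *: ext_incl u + ext_incl v.
  by apply: injective_projections; rewrite /= ?scaler0 ?addr0.
split=> [a u v w|u v|u u0]; rewrite /h.
- by rewrite inclP (spDl ipP) (spZl ipP).
- exact: (spC ipP).
- case: ipP => _ _; apply; apply: contra u0 => /eqP e.
  by apply/eqP; have := congr1 snd e.
Qed.
Let hP := sp_incl_scalar_product.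

Lemma sp_incl_sym u v : h (L u) v = h u (L v).
Proof. exact: hL. Qed.

Lemma sp_incl_symC u v : h (L u) v = h (L v) u.
Proof. by rewrite sp_incl_sym (spC hP). Qed.

Lemma ip_split x y : ip x y = x.1 * y.1 + h x.2 y.2.
Proof.
have split (z : ext_alg R n) : z = z.1 *: ext_b + ext_incl z.2.
  apply: injective_projections; rewrite /= ?addr0 ?scaler0 ?add0r//.
  by rewrite [_ *: _]mulr1.
rewrite {1}[x]split {1}[y]split !(spDl ipP, spDr ipP, spZl ipP, spZr ipP).
by rewrite hb hbu (spC ipP _ ext_b) hbu mulr1 !mulr0 addr0 add0r.
Qed.

(** The Levi-Civita connection on left invariant fields: the covariant derivative
    along b vanishes, the one along u sends b to - L u and v to <L u, v> b. *)
Definition lc_product (x y : ext_alg R n) : ext_alg R n :=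
  (h (L x.2) y.2, - y.1 *: L x.2).

(** The Weyl connection defined by a b, on left invariant fields. *)
Definition weyl_product (a : R) (x y : ext_alg R n) : ext_alg R n :=
  (h (L x.2) y.2 + a * (x.1 * y.1) - a * h x.2 y.2,
   (a * x.1) *: y.2 - y.1 *: (L x.2 - a *: x.2)).

Lemma lc_product_koszul x y z :
  ip (ext_bracket L x y) z - ip (ext_bracket L y z) x + ip (ext_bracket L z x) y
  = 2 * ip (lc_product x y) z.
Proof.
case: x y z => [s u] [t v] [r w]; rewrite !ip_split /=.
rewrite !(spDl hP) !(spNl hP) !(spZl hP).
rewrite (sp_incl_symC w u) (sp_incl_symC v u) (sp_incl_symC w v).
by ring.
Qed.

(** The bilinear form of L - a. *)
Definition shift_form (a : R) (u v : 'rV[R]_n) : R := h (L u) v - a * h u v.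

(** The sectional curvature of the Weyl connection on the plane spanned by the
    orthonormal vectors x and y. *)
Definition weyl_form (a : R) (x y : ext_alg R n) : R :=
  let w := x.1 *: y.2 - y.1 *: x.2 in
  - (shift_form a x.2 x.2 * shift_form a y.2 y.2 - shift_form a x.2 y.2 ^+ 2)
  - (h (L w) (L w) - a * h (L w) w).

(** Orthonormality expresses the scalar products of u and v through s and t; what
    then remains is a polynomial identity. *)
Lemma weyl_form_curvature a x y : ip x x = 1 -> ip y y = 1 -> ip x y = 0 ->
  ip (weyl_product a x (weyl_product a y y) -
      weyl_product a y (weyl_product a x y) -
      weyl_product a (ext_bracket L x y) y) x = weyl_form a x y.
Proof.
rewrite !ip_split; case: x y => [s u] [t v] /= xx yy xy.
have huu : h u u = 1 - s ^+ 2 by rewrite -xx; ring.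
have hvv : h v v = 1 - t ^+ 2 by rewrite -yy; ring.
have huv : h u v = - (s * t) by rewrite -[RHS]add0r -xy; ring.
rewrite /weyl_form /shift_form /=.
rewrite ?(linearB L) ?(linearD L) ?(linearZ_LR L).
(* each pass only reaches the vectors that the previous one exposed *)
do 5 rewrite ?(spDl hP) ?(spNl hP) ?(spZl hP) ?(spDr hP) ?(spNr hP) ?(spZr hP).
rewrite !(sp_incl_sym (L _)) -!(sp_incl_sym u) -(sp_incl_sym v u).
rewrite (sp_incl_symC v u) (spC hP (L v) (L u)) (spC hP v u) huu hvv huv.
by ring.
Qed.


Section Sign.
Variables (mu : n.-tuple R).
Hypothesis charL : char_poly (lin1_mx L) = \prod_(a <- mu) ('X - a%:P).

(** The operator sgn (L - a) is positive semi-definite for a suitable sign, and the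
    inequality is the same for both signs. *)
Lemma shift_form_CS a : (forall c, c \in mu -> a <= c) \/
    (forall c, c \in mu -> c <= a) ->
  forall u v, shift_form a u v ^+ 2 <= shift_form a u u * shift_form a v v.
Proof.
have form u (sgn : R) : (forall c, c \in mu -> 0 <= sgn * (c - a)) ->
    0 <= sgn * shift_form a u u.
  move=> semi; have [e e0 [uu Luu _]] := spectral_form hP sp_incl_sym charL u.
  rewrite /shift_form Luu uu mulr_sumr -sumrB mulr_sumr big_seq_cond.
  apply: sumr_ge0 => c /andP[]; rewrite mem_undup => cmu _.
  by rewrite -mulrBl mulrA mulr_ge0// semi.
move=> semi u v.
have [sgn sgn2 sgnP] : exists2 sgn : R, sgn ^+ 2 = 1 &
    forall c, c \in mu -> 0 <= sgn * (c - a).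
  case: semi => semi; [exists 1|exists (-1)]; rewrite ?sqrrN ?expr1n// => c cmu.
    by rewrite mul1r subr_ge0 semi.
  by rewrite mulN1r opprB subr_ge0 semi.
pose A w := sgn *: (L w - a *: w).
have hA w w' : h (A w) w' = sgn * shift_form a w w'.
  by rewrite /A (spZl hP) (spBl hP) (spZl hP).
have Al : linear A.
  by move=> c w w'; rewrite /A linearP; apply/rowP => j; rewrite !mxE; ring.
have Asym w w' : h (A w) w' = h w (A w').
  by rewrite (spC hP w) !hA /shift_form sp_incl_symC (spC hP w).
have := semidefinite_CS hP Al Asym (fun w => _) u v.
rewrite !hA exprMn sgn2 mul1r mulrACA -expr2 sgn2 mul1r; apply => w.
by rewrite hA; apply: form.
Qed.

(** Two unit eigenvectors for the eigenvalues c and d span a plane of curvature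
    - (c - a) (d - a), while b and a unit eigenvector for c span a plane of
    curvature - c (c - a). Conversely, if some eigenvalue is less than a then the
    pairwise condition forces all the others to be at most a. *)
Lemma weyl_form_npos a :
  (forall x y, ip x x = 1 -> ip y y = 1 -> ip x y = 0 -> weyl_form a x y <= 0)
  <-> (forall c d, c \in mu -> d \in mu -> c != d -> 0 <= (c - a) * (d - a)) /\
      (forall c, c \in mu -> 0 <= c * (c - a)).
Proof.
split=> [npos|[pairs single] x y xx yy xy].
  have incl u v : ip (ext_incl u) (ext_incl v) = h u v by [].
  split=> [c d cmu dmu cd|c cmu].
    have [u Lu uu] := unit_eigenvector hP charL cmu.
    have [v Lv vv] := unit_eigenvector hP charL dmu.
    have uv := eigenvector_orthogonal hP sp_incl_sym Lu Lv cd.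
    have := npos (ext_incl u) (ext_incl v); rewrite !incl => /(_ uu vv uv).
    rewrite /weyl_form /shift_form /= !scale0r subr0 linear0 Lu Lv.
    by rewrite !(spZl hP) uu vv uv !(sp0l hP); lra.
  have [u Lu uu] := unit_eigenvector hP charL cmu.
  have := npos ext_b (ext_incl u); rewrite incl hb uu hbu => /(_ erefl erefl erefl).
  rewrite /weyl_form /shift_form /= scale0r subr0 scale1r Lu linear0.
  by rewrite !(spZl hP, spZr hP) uu !(sp0l hP); lra.
rewrite /weyl_form /=; set w := x.1 *: y.2 - y.1 *: x.2; rewrite -opprD oppr_le0 addr_ge0//.
  rewrite subr_ge0; apply: shift_form_CS.
  have [/hasP[c cmu ca]|/hasPn all_ge] := boolP (has (fun c => c < a) mu).
    right=> d dmu; have [<-|cd] := eqVneq c d; first exact: ltW.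
    have := pairs _ _ cmu dmu cd.
    by rewrite nmulr_rge0 ?subr_lt0// subr_le0.
  by left=> c cmu; rewrite leNgt; apply: all_ge.
have [e e0 [_ -> ->]] := spectral_form hP sp_incl_sym charL w.
rewrite mulr_sumr -sumrB big_seq_cond; apply: sumr_ge0 => c /andP[].
rewrite mem_undup => cmu _.
have -> : c ^+ 2 * e c - a * (c * e c) = c * (c - a) * e c by ring.
by rewrite mulr_ge0// single.
Qed.

End Sign.

End ExtensionCurvature.

(** * From the Lie algebra to the Lie group *)

Section WeylLeftInvariant.
Context {R : realType} {n : nat}.
Variable L : {linear 'rV[R]_n -> 'rV[R]_n}.
Variable ip : ext_alg R n -> ext_alg R n -> R.
Hypotheses (ipP : scalar_product ip) (hb : ip ext_b ext_b = 1)
  (hbu : forall u : 'rV[R]_n, ip ext_b (ext_incl u) = 0).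
Hypothesis hL : forall u v : 'rV[R]_n,
  ip (ext_incl (L u)) (ext_incl v) = ip (ext_incl u) (ext_incl (L v)).
Variables (S : lie_group R n.+1) (iota : ext_alg R n -> vfield S).
Hypothesis hiota : lie_algebra_iso (ext_bracket L) iota.
Variable g : S -> 'rV[R]_n.+1 -> 'rV[R]_n.+1 -> R.
Hypothesis hg : left_invariant_metric ip iota g.
Variable nabla : vfield S -> vfield S -> vfield S.
Hypothesis hnabla : levi_civita g nabla.
Variable alpha : R.
Let E := iota (alpha *: ext_b).

Lemma nabla_iota x y : nabla (iota x) (iota y) = iota (lc_product L ip x y).
Proof.
apply/funext => p; apply: (metric_iota_inj hiota ipP hg) => z.
have two : (2 : R) != 0 by rewrite pnatr_eq0.
apply: (mulfI two).
apply: etrans (koszul_left_invariant hiota hg x y z p hnabla) _.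
by rewrite (metric_iota hiota hg) (lc_product_koszul ipP hb hbu hL).
Qed.

Lemma weyl_iota x y :
  weyl g nabla E (iota x) (iota y) = iota (weyl_product L ip alpha x y).
Proof.
apply/funext => p; rewrite /weyl nabla_iota /E !(pairing_iota hiota hg).
rewrite -!(left_inv_scale hiota) -!(left_inv_add hiota) -(left_inv_sub hiota); congr (iota _ p).
have ipE z : ip (alpha *: ext_b) z = alpha * z.1.
  rewrite (spZl ipP) (ip_split ipP hb hbu) /= mul1r.
  by rewrite (sp0l (sp_incl_scalar_product ipP)) addr0.
rewrite !ipE (ip_split ipP hb hbu); case: x y => [s u] [t v].
apply: injective_projections => /=.
  by rewrite /GRing.scale /=; ring.
by apply/rowP => j; rewrite !mxE; ring.
Qed.


(** The dform term drops out because X and Y are orthogonal at p. *)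
Lemma weyl_sect_iota x y (X Y : vfield S) p :
  smooth_vfield X -> smooth_vfield Y -> X p = iota x p -> Y p = iota y p ->
  ip x x = 1 -> ip y y = 1 -> ip x y = 0 ->
  weyl_sect g nabla E X Y p = weyl_form L ip alpha x y.
Proof.
move=> sX sY Xp Yp xx yy xy; have [[gP gs] _ _] := hg.
have sE : smooth_vfield E := smooth_iota hiota _.
have cW := weyl_connection (conj gP gs) hnabla sE.
rewrite /weyl_sect /pairing /curvature_anti (spBl (gP p)) (spZl (gP p)).
rewrite (curvature_left_invariant hiota ipP hg cW sX sY Xp Yp) Xp Yp.
rewrite (spC (gP p) (iota y p)) (metric_iota hiota hg) xy mulr0 subr0.
rewrite /curvature -(iota_bracket hiota) !weyl_iota -!(left_inv_sub hiota).
rewrite (metric_iota hiota hg).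
exact: weyl_form_curvature.
Qed.

Lemma weyl_nonpositiveP : weyl_nonpositive g nabla E <->
  (forall x y, ip x x = 1 -> ip y y = 1 -> ip x y = 0 ->
     weyl_form L ip alpha x y <= 0).
Proof.
split=> [npos x y xx yy xy|npos p X Y sX sY].
  have sx := smooth_iota hiota x; have sy := smooth_iota hiota y.
  have := npos (gone S) (iota x) (iota y) sx sy.
  rewrite !(metric_iota hiota hg) => /(_ xx yy xy).
  by rewrite (weyl_sect_iota sx sy erefl erefl xx yy xy).
have [x Xp] := iota_surj_at hiota ipP hg p (X p).
have [y Yp] := iota_surj_at hiota ipP hg p (Y p).
rewrite Xp Yp !(metric_iota hiota hg) => xx yy xy.
rewrite (weyl_sect_iota sX sY Xp Yp xx yy xy).
exact: npos.
Qed.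

End WeylLeftInvariant.

Theorem theorem5p1 (R : realType) (n : nat) (hn : (2 <= n)%N)
  (L : {linear 'rV[R]_n -> 'rV[R]_n})
  (ip : ext_alg R n -> ext_alg R n -> R)
  (hip : scalar_product ip)
  (hb : ip ext_b ext_b = 1)
  (hbu : forall u : 'rV[R]_n, ip ext_b (ext_incl u) = 0)
  (hL : forall u v : 'rV[R]_n,
     ip (ext_incl (L u)) (ext_incl v) = ip (ext_incl u) (ext_incl (L v)))
  (mu : n.-tuple R) (hmu : sorted_eigenvalues L mu) (hmu0 : 0 \notin mu)
  (S : lie_group R n.+1) (iota : ext_alg R n -> vfield S)
  (hiota : lie_algebra_iso (ext_bracket L) iota)
  (g : S -> 'rV[R]_n.+1 -> 'rV[R]_n.+1 -> R)
  (hg : left_invariant_metric ip iota g)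
  (nabla : vfield S -> vfield S -> vfield S)
  (hnabla : levi_civita g nabla)
  (alpha : R) :
  let mu1 := mu`_0 in
  let mun := mu`_n.-1 in
  let E := iota (alpha *: ext_b) in
  [/\ mu1 < 0 -> 0 < mun ->
        (weyl_nonpositive g nabla E <->
         (alpha = mu1 /\ (forall a, a \in mu -> a < 0 -> a = mu1)) \/
         (alpha = mun /\ (forall a, a \in mu -> 0 < a -> a = mun))),
      0 < mu1 -> (weyl_nonpositive g nabla E <-> alpha <= mu1)
    & mun < 0 -> (weyl_nonpositive g nabla E <-> mun <= alpha)].
Proof.
move=> mu1 mun E; case: hmu => mu_sorted charL.
have n0 : (0 < n)%N by apply: leq_trans hn.
have nth_mu i : (i < n)%N -> mu`_i \in mu by move=> i_n; rewrite mem_nth ?size_tuple.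
have mu1P : mu1 \in mu by exact: nth_mu.
have munP : mun \in mu by apply: nth_mu; rewrite prednK.
have bounds a : a \in mu -> mu1 <= a <= mun.
  move=> /(nthP 0)[i]; rewrite size_tuple => i_n <-.
  have mono i1 i2 : (i1 <= i2)%N -> (i2 < n)%N -> mu`_i1 <= mu`_i2.
    move=> i12 i2n; apply: (le_sorted_leq_nth 0 mu_sorted) => //.
      by rewrite inE size_tuple (leq_ltn_trans i12).
    by rewrite inE size_tuple.
  by rewrite !mono ?prednK// -ltnS prednK.
have P : weyl_nonpositive g nabla E <->
    (forall c d, c \in mu -> d \in mu -> c != d ->
       0 <= (c - alpha) * (d - alpha)) /\
    (forall c, c \in mu -> 0 <= c * (c - alpha)).
  apply: iff_trans (weyl_nonpositiveP hip hb hbu hL hiota hg hnabla alpha) _.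
  exact: (weyl_form_npos hip hb hbu hL charL alpha).
(* sufficiency: eigenvalues on one side of alpha satisfy the pairwise condition *)
have sufficient (Q : Prop) : (Q -> forall a, a \in mu -> 0 <= a * (a - alpha)) ->
    (Q -> (forall a, a \in mu -> alpha <= a) \/ (forall a, a \in mu -> a <= alpha)) ->
    Q -> weyl_nonpositive g nabla E.
  move=> single semi q; apply/P; split=> [c d cmu dmu _|c cmu]; last exact: single.
  case: (semi q) => s.
    by rewrite mulr_ge0// subr_ge0 s.
  by rewrite mulr_le0// subr_le0 s.
split=> [mu1_lt0 mun_gt0|mu1_gt0|mun_lt0].
- split=> [/P[pairs single]|].
    have neg a : a \in mu -> a < 0 -> a <= alpha.
      by move=> amu a0; have := single a amu; rewrite nmulr_rge0// subr_le0.
    have pos a : a \in mu -> 0 < a -> alpha <= a.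
      by move=> amu a0; have := single a amu; rewrite pmulr_rge0// subr_ge0.
    have mu1n : mu1 != mun by rewrite lt_eqF// (lt_trans mu1_lt0).
    (* mu1 <= alpha <= mun, so the product condition forces an equality *)
    have := pairs _ _ mu1P munP mu1n.
    have [mu1a|mu1a] := eqVneq mu1 alpha.
      move=> _; left; split=> // a amu a0; apply/eqP; rewrite eq_le.
      by have /andP[-> _] := bounds a amu; rewrite mu1a neg.
    rewrite nmulr_rge0; last by rewrite subr_lt0 lt_neqAle mu1a neg.
    rewrite subr_le0 => mun_le; right.
    have alphaE : alpha = mun by apply/eqP; rewrite eq_le mun_le pos.
    split=> // a amu a0; apply/eqP; rewrite eq_le.
    by have /andP[_ ->] := bounds a amu; rewrite -alphaE pos.
  apply: sufficient => [[] [-> all_eq] a amu|[] [-> _]].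
  + have [a0|a0] := ltP a 0; first by rewrite (all_eq a)// subrr mulr0.
    by rewrite mulr_ge0// subr_ge0; have /andP[] := bounds a amu.
  + have [a0|a0] := ltP 0 a; first by rewrite (all_eq a)// subrr mulr0.
    by rewrite mulr_le0// subr_le0; have /andP[] := bounds a amu.
  + by left=> a /bounds/andP[].
  + by right=> a /bounds/andP[].
- split=> [/P[_ /(_ _ mu1P)]|]; first by rewrite pmulr_rge0// subr_ge0.
  have ge_mu1 a : a \in mu -> mu1 <= a by move/bounds/andP => [].
  apply: sufficient => le_mu1 => [a /ge_mu1 a1|].
    by rewrite mulr_ge0 ?subr_ge0 ?(le_trans le_mu1)// (le_trans (ltW mu1_gt0)).
  by left=> a /ge_mu1; apply: le_trans.
- split=> [/P[_ /(_ _ munP)]|]; first by rewrite nmulr_rge0// subr_le0.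
  have le_mun a : a \in mu -> a <= mun by move/bounds/andP => [].
  apply: sufficient => ge_mun => [a /le_mun a1|].
    rewrite mulr_le0 ?subr_le0 ?(le_trans _ ge_mun)//.
    exact: le_trans a1 (ltW mun_lt0).
  by right=> a /le_mun a1; apply: le_trans ge_mun.
Qed.
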